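(* In the setting of the context, assume $\widetilde S$ is infinite and let $\widetilde{p_K}:=-u+Kv$. Then for all sufficiently large integers $K$ with $\widetilde{p_K}\in\widetilde S$, $\widetilde{p_K}$ divides the denominator of $\widetilde h(K)$, and $\widetilde h(J)$ is $\widetilde{p_K}$-integral for every positive integer $J<K$. Thus the set of primes dividing the denominator of $\widetilde h(K)$ for some $K$ is infinite and has positive density within the set of primes.
   Context: $q=e^{2\pi i\tau}$, $q^s=e^{2\pi is\tau}$, $\Gamma_0(2)=\{\gamma\in\mathrm{SL}_2(\mathbf{Z}):\gamma_{21}\equiv0\bmod2\}$, $T=\begin{pmatrix}1&1\\0&1\end{pmatrix}$. $E_2=1-24\sum\sigma(n)q^n$, $E_4=1+240\sum\sigma_3(n)q^n$, $G(\tau)=-E_2(\tau)+2E_2(2\tau)$, $\mathfrak{J}=\frac{3G^2}{E_4-G^2}$, $\mathfrak{K}=64\mathfrak{J}=q^{-1}(1+O(q))\in q^{-1}\mathbf{Z}[[q]]^\times$, $D_kA=\frac{1}{2\pi i}A'-\frac{k}{12}E_2A$. Setting: $\rho:\Gamma_0(2)\to\mathrm{GL}_2(\mathbf{C})$ irreducible; $k_0$ least with $M_{k_0}(\rho)\ne0$ (holomorphic weight-$k_0$ vector-valued modular forms), $F\ne0$ in it; $a,b,c$ unique with $D_{k_0+2}D_{k_0}F+aGD_{k_0}F+(bG^2+cE_4)F=0$; $r$ a root of $r^2-(a+\frac13)r+b+4c=0$. Standing assumption: $\rho(T)$ of finite order, $c\in\mathbf{Q}$, $[\mathbf{Q}(r):\mathbf{Q}]=2$.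 Fix $X$ with $X\rho(T)X^{-1}=\mathrm{diag}(e^{2\pi im_1},e^{2\pi im_2})$ ($|m_1|\le|m_2|$); components of $XF$ are $\lambda_iq^{k_0/12+l_i}(1+O(q))$, $\lambda_i\ne0$; $A=r+l_1$, $B=r+l_2$; $A-B=u/v$, $u,v\in\mathbf{Z}$, $v>1$, $\gcd(u,v)=1$. $M$ square-free with $\mathbf{Q}(r)=\mathbf{Q}(\sqrt M)$; $\widetilde S$ = odd primes $p$ with $M$ a non-residue mod $p$ and $p\equiv-u\pmod v$. Writing $\mathfrak{K}^{-1}=q(1+Y)$, $Y\in q\mathbf{Z}[[q]]$, and $\mathfrak{J}^{-B}(\mathfrak{J}-1)^r:=64^{B-r}q^{B-r}(1+Y)^{B-r}(1-64\mathfrak{K}^{-1})^r$ (binomial series), $\widetilde h(K)$ is defined by $\mathfrak{J}^{-B}(\mathfrak{J}-1)^r{}_2F_1(B,\frac12+B,1+B-A;\mathfrak{J}^{-1})=64^{B-r}q^{B-r}(1+\sum_{K\ge1}\widetilde h(K)q^K)$. An algebraic number is $p$-integral if $p$ does not divide its denominator (least positive $N$ with $N\zeta$ an algebraic integer). *)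

(* Defs.v *)
From HB Require Import structures.
From mathcomp Require Import all_boot all_order all_algebra.
From mathcomp Require Import complex.
From mathcomp Require Import all_classical all_reals all_analysis.

Set Implicit Arguments.
Unset Strict Implicit.
Unset Printing Implicit Defensive.

Import Order.TTheory GRing.Theory Num.Theory numFieldNormedType.Exports.

Local Open Scope classical_set_scope.
Local Open Scope ring_scope.
Local Open Scope complex_scope.

(* The complex numbers are R[i]; the library puts the normed topology on the
   regular module R[i]^o, hence the casts to R[i]^o below. *)

Definition upper_half_plane (R : realType) : set R[i] :=
  [set tau | 0 < complex.Im tau].

Definition cexp (R : realType) (z : R[i]) : R[i] :=
  (expR (complex.Re z))%:C * (cos (complex.Im z) +i* sin (complex.Im z)).

(* ee z = e^{2 pi i z}; thus q = ee tau and q^s = ee (s * tau). *)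
Definition ee (R : realType) (z : R[i]) : R[i] :=
  cexp ((0 +i* (2 * pi)) * z).

Definition cderive (R : realType) (f : R[i] -> R[i]) (z : R[i]) : R[i] :=
  'D_1 (f : R[i]^o -> R[i]^o) z.

Definition cderivable (R : realType) (f : R[i] -> R[i]) (z : R[i]) : Prop :=
  derivable (f : R[i]^o -> R[i]^o) z 1.

Definition qsum (R : realType) (f : nat -> R[i]) (tau : R[i]) : nat -> R[i]^o :=
  fun N => \sum_(n < N) f n * ee tau ^+ n.

(** Eisenstein series *)

Definition sigma (k n : nat) : nat := \sum_(d <- divisors n) d ^ k.

Definition E2_coef (n : nat) : int :=
  if n is 0%N then 1 else - (24 * (sigma 1 n)%:Z).

Definition E4_coef (n : nat) : int :=
  if n is 0%N then 1 else 240 * (sigma 3 n)%:Z.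

Definition G_coef (n : nat) : int :=
  - E2_coef n + 2 * (if (2 %| n)%N then E2_coef (n %/ 2) else 0).

Definition E2 (R : realType) (tau : R[i]) : R[i] :=
  lim (qsum (fun n => (E2_coef n)%:~R) tau @ \oo).

Definition E4 (R : realType) (tau : R[i]) : R[i] :=
  lim (qsum (fun n => (E4_coef n)%:~R) tau @ \oo).

Definition G (R : realType) (tau : R[i]) : R[i] :=
  - E2 tau + 2 * E2 (2 * tau).

(** Groups and representations *)

Definition SL2Z : set 'M[int]_2 := [set g | \det g = 1].

Definition Gamma0_2 : set 'M[int]_2 := [set g | SL2Z g /\ (2 %| (g 1 0)%R)%Z].

Definition Tmx : 'M[int]_2 := 1%:M + delta_mx 0 1.

(* Only the values of rho on Gamma0_2 matter. *)
Definition is_rep (R : realType) (rho : 'M[int]_2 -> 'M[R[i]]_2) : Prop :=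
  (forall g, Gamma0_2 g -> rho g \in unitmx) /\
  (forall g h, Gamma0_2 g -> Gamma0_2 h -> rho (g *m h) = rho g *m rho h).

(* rho acts on column vectors; MathComp subspaces are row spaces, whence the
   transpose. *)
Definition irreducible_rep (R : realType) (rho : 'M[int]_2 -> 'M[R[i]]_2)
    : Prop :=
  forall V : 'M[R[i]]_2,
    (forall g, Gamma0_2 g -> stablemx V (rho g)^T) -> V = 0 \/ row_full V.

(** Vector-valued modular forms *)

Definition autfac (R : realType) (g : 'M[int]_2) (tau : R[i]) : R[i] :=
  (g 1 0)%:~R * tau + (g 1 1)%:~R.

Definition mobius (R : realType) (g : 'M[int]_2) (tau : R[i]) : R[i] :=
  ((g 0 0)%:~R * tau + (g 0 1)%:~R) / autfac g tau.

Definition slash (R : realType) (k : int) (g : 'M[int]_2)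
    (F : R[i] -> 'cV[R[i]]_2) (tau : R[i]) : 'cV[R[i]]_2 :=
  autfac g tau ^ (- k) *: F (mobius g tau).

(* At most polynomial growth in Im tau, in every vertical strip: for the slash
   transforms of a modular form this says that the real parts of the exponents
   in the q-expansion are nonnegative, also in the logarithmic case. *)
Definition moderate_growth (R : realType) (F : R[i] -> 'cV[R[i]]_2) : Prop :=
  forall x0 : R, exists (K y0 : R) (N : nat), 0 < y0 /\
    forall tau : R[i], `|complex.Re tau| <= x0 -> y0 <= complex.Im tau ->
      forall j, `|F tau j 0| <= (K * complex.Im tau ^+ N)%:C.

(* F \in M_k(rho); only the values of F on the upper half plane matter. *)
Definition vvmf (R : realType) (rho : 'M[int]_2 -> 'M[R[i]]_2) (k : int)
    (F : R[i] -> 'cV[R[i]]_2) : Prop :=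
  [/\ forall tau, upper_half_plane tau ->
        forall j, cderivable (fun t => F t j 0) tau,
      forall g, Gamma0_2 g -> forall tau, upper_half_plane tau ->
        slash k g F tau = rho g *m F tau &
      forall g, SL2Z g -> moderate_growth (slash k g F)].

Definition nonzero_form (R : realType) (F : R[i] -> 'cV[R[i]]_2) : Prop :=
  exists2 tau, upper_half_plane tau & F tau != 0.

Definition least_weight (R : realType) (rho : 'M[int]_2 -> 'M[R[i]]_2)
    (k0 : int) : Prop :=
  (exists F, vvmf rho k0 F /\ nonzero_form F) /\
  (forall k F, vvmf rho k F -> nonzero_form F -> k0 <= k).

Definition Dk (R : realType) (k : int) (F : R[i] -> 'cV[R[i]]_2) (tau : R[i])
    : 'cV[R[i]]_2 :=
  \col_j ((0 +i* (2 * pi))^-1 * cderive (fun t => F t j 0) tau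
          - k%:~R / 12 * E2 tau * F tau j 0).

(* f = lambda q^s (1 + O(q)) with lambda <> 0, as a convergent q-expansion. *)
Definition leading_exponent (R : realType) (f : R[i] -> R[i]) (s : R[i])
    : Prop :=
  exists (lambda : R[i]) (c : nat -> R[i]),
    [/\ lambda != 0, c 0%N = 1 &
        forall tau, upper_half_plane tau ->
          exists2 w : R[i], qsum c tau @ \oo --> (w : R[i]^o) &
                            f tau = lambda * ee (s * tau) * w].

(** Algebraic numbers *)

Definition is_rational (R : realType) (z : R[i]) : Prop :=
  exists x : rat, z = ratr x.

(* The field Q(x). *)
Definition Qadj (R : realType) (x : R[i]) : set R[i] :=
  [set z | exists f g : {poly rat},
     (map_poly ratr g).[x] != 0 /\
     z = (map_poly ratr f).[x] / (map_poly ratr g).[x]].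

(* [K : Q] = n, through a Q-basis of K. *)
Definition Qdegree (R : realType) (K : set R[i]) (n : nat) : Prop :=
  exists e : 'I_n -> R[i], (forall i, K (e i)) /\
    forall z, K z ->
      exists! x : {ffun 'I_n -> rat}, z = \sum_i ratr (x i) * e i.

Definition squarefree (M : int) : Prop :=
  forall d : int, (d ^+ 2 %| M)%Z -> `|d|%N = 1%N.

Definition algebraic_integer (R : realType) (z : R[i]) : Prop :=
  integralOver (intr : int -> R[i]) z.

Definition is_denominator (R : realType) (z : R[i]) (N : nat) : Prop :=
  [/\ (0 < N)%N, algebraic_integer (N%:R * z) &
      forall N', (0 < N')%N -> algebraic_integer (N'%:R * z) -> (N <= N')%N].

Definition divides_denominator (R : realType) (p : nat) (z : R[i]) : Prop :=
  exists2 N, is_denominator z N & (p %| N)%N.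

Definition p_integral (R : realType) (p : nat) (z : R[i]) : Prop :=
  exists2 N, is_denominator z N & ~~ (p %| N)%N.

Definition Stilde (M u v : int) : set nat :=
  [set p | [/\ prime p, odd p,
               ~ (exists x : int, (x ^+ 2 = M %[mod p%:Z])%Z) &
               (p%:Z = - u %[mod v])%Z]].

(** Formal power series in q, as coefficient sequences *)

Definition fps_mul (K : fieldType) (f g : nat -> K) (n : nat) : K :=
  \sum_(i < n.+1) f i * g (n - i)%N.

Definition fps_exp (K : fieldType) (f : nat -> K) (j : nat) : nat -> K :=
  iter j (fps_mul f) (fun n => (n == 0%N)%:R).

(* g(f), for f with zero constant term. *)
Definition fps_comp (K : fieldType) (g f : nat -> K) (n : nat) : K :=
  \sum_(j < n.+1) g j * fps_exp f j n.

Definition gbinom (K : fieldType) (s : K) (j : nat) : K :=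
  (\prod_(i < j) (s - i%:R)) / (j`!)%:R.

(* f^s by the binomial series, for f with constant term 1; s = -1 gives the
   inverse of f. *)
Definition fps_powc (K : fieldType) (f : nat -> K) (s : K) : nat -> K :=
  fps_comp (gbinom s) (fun n => f n - (n == 0%N)%:R).

Definition pochhammer (K : fieldType) (x : K) (n : nat) : K :=
  \prod_(i < n) (x + i%:R).

Definition hyp2F1 (K : fieldType) (x y z : K) (n : nat) : K :=
  pochhammer x n * pochhammer y n / (pochhammer z n * (n`!)%:R).

Definition G2_fps (K : fieldType) : nat -> K :=
  fps_mul (fun n => (G_coef n)%:~R) (fun n => (G_coef n)%:~R).

(* J^-1 = (E_4 - G^2) / (3 G^2) *)
Definition Jinv (K : fieldType) (n : nat) : K :=
  fps_mul (fun m => (E4_coef m)%:~R - G2_fps K m) (fps_powc (G2_fps K) (-1)) n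
  / 3.

Definition Kinv (K : fieldType) (n : nat) : K := Jinv K n / 64.

(* The series 1 + Y, where K^-1 = q (1 + Y). *)
Definition oneY (K : fieldType) (n : nat) : K := Kinv K n.+1.

(* The coefficients of
   (1 + Y)^(B - r) (1 - 64 K^-1)^r 2F1(B, 1/2 + B, 1 + B - A; J^-1);
   the constant coefficient is 1. *)
Definition htilde (K : fieldType) (A B r : K) : nat -> K :=
  fps_mul (fps_powc (oneY K) (B - r))
    (fps_mul (fps_powc (fun n => (n == 0%N)%:R - 64 * Kinv K n) r)
             (fps_comp (hyp2F1 B (1 / 2 + B) (1 + B - A)) (Jinv K))).

(** Density in the set of primes *)

Definition prime_count (P : set nat) (n : nat) : nat :=
  count (fun p => prime p && `[< P p >]) (iota 0 n.+1).

(* liminf #{p <= n prime, p in P} / #{p <= n prime} *)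
Definition lower_prime_density (R : realType) (P : set nat) : R :=
  limn_inf (fun n => (prime_count P n)%:R / (prime_count setT n)%:R : R).

(* Main.v *)
Require Import Defs.
From HB Require Import structures.
From mathcomp Require Import all_boot all_order all_algebra.
From mathcomp Require Import all_field complex.
From mathcomp Require Import all_classical all_reals all_analysis.
From mathcomp Require Import zify ring lra.

Set Implicit Arguments.
Unset Strict Implicit.
Unset Printing Implicit Defensive.

Import Order.TTheory GRing.Theory Num.Theory numFieldNormedType.Exports.

Local Open Scope classical_set_scope.
Local Open Scope ring_scope.
Local Open Scope complex_scope.

(** Write [s = sqrt M] and call an odd prime [p] inert when [M] is not a square
modulo [p].  Since [rho(T)] has finite order, the exponents [l_j] are rational,
and [r = x + y s] with [x], [y] rational and [y <> 0].  Hence, for [p] inert and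
large, every factor [B + i] and [1/2 + B + i] of the hypergeometric numerators
is a [p]-adic unit (its norm is [X^2 - M Y^2] up to units, with [p] not dividing
[Y]), whereas the denominators [(1 + B - A)_n] contain the factors [v i - u].  If
[0 < K < p] and [p | v K - u], the hypergeometric coefficient of index [K] is the
first one that fails to be [p]-integral, and all the other ingredients of
[htilde] are [p]-integral up to index [K].  This gives the first claim, and it
shows that every large inert prime divides the denominator of some [htilde K],
with no congruence condition modulo [v].

It remains to see that the inert primes have positive lower density.  As [s]
lies in the cyclotomic field of level [8 |M|], the action of the Galois group on
[s] defines a quadratic Dirichlet character [chi], and the Frobenius congruence
shows that [chi p = -1] forces [p] to be inert.  Let [L] be the sum of the
series [chi n / n].  If [L <> 0], Mertens' argument gives that the sum of
[ln p / p] over [chi p = -1], [p <= X], is [(ln X) / 2 + O(1)].  If [L = 0], the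
nonnegative convolution [1 * chi] has partial sums [O(sqrt X)], so almost all
primes satisfy [chi p = -1] (this spares a proof that [L <> 0]).  In both cases
Chebyshev's bounds conclude. *)

(** * Elementary estimates for logarithms *)

Section ElementaryEstimates.
Variable R : realType.
Implicit Types (n X : nat).

Local Notation lnn n := (ln (n%:R : R)).

Lemma lnn_ge0 n : 0 <= lnn n.
Proof.
case: n => [|n]; first by rewrite ln0.
by apply: ln_ge0; rewrite ler1n.
Qed.

Lemma lnn_le m n : (0 < m)%N -> (m <= n)%N -> lnn m <= lnn n.
Proof.
move=> m0 mn; rewrite ler_ln ?posrE ?ltr0n ?ler_nat //.
exact: leq_trans m0 mn.
Qed.

Lemma lnnM m n : (0 < m)%N -> (0 < n)%N -> lnn (m * n) = lnn m + lnn n.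
Proof. by move=> m0 n0; rewrite natrM lnM // posrE ltr0n. Qed.

Lemma lnn_prod (I : eqType) (s : seq I) (P : pred I) (F : I -> nat) :
  (forall i, P i -> (0 < F i)%N) ->
  lnn (\prod_(i <- s | P i) F i) = \sum_(i <- s | P i) lnn (F i).
Proof.
move=> F0; elim: s => [|i s IH]; first by rewrite !big_nil ln1.
rewrite !big_cons; case: ifPn => // Pi.
by rewrite lnnM ?F0 // ?IH // prodn_cond_gt0.
Qed.

(** [ln (1 + 1/n) <= 1/n]; this drives the comparisons of consecutive logarithms in this section. *)
Lemma lnnS_sub n : (0 < n)%N -> n%:R * (lnn n.+1 - lnn n) <= 1.
Proof.
move=> n0; have n0R : 0 < n%:R :> R by rewrite ltr0n.
rewrite -ln_div ?posrE ?ltr0n //.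
have -> : n.+1%:R / n%:R = 1 + n%:R^-1 :> R by rewrite -natr1; field; rewrite gt_eqF.
rewrite -ler_pdivlMl // mulr1; apply: le_ln1Dx.
by apply: (@lt_trans _ _ 0); rewrite ?ltrN10 // invr_gt0.
Qed.

(** Weak Stirling bound. From [X] to [X + 1] the left side grows by [ln (X + 1)] plus
    [X (ln (X + 1) - ln X) - 1], which is nonpositive. *)
Lemma sum_lnn_ge X : X%:R * lnn X - X%:R <= \sum_(1 <= n < X.+1) lnn n.
Proof.
elim: X => [|X IH]; first by rewrite big_geq // mul0r subrr.
rewrite big_nat_recr //=.
case: X IH => [|X] IH; first by rewrite big_geq // ln1; lra.
have := @lnnS_sub X.+1 isT; rewrite -(natr1 X.+1) => h; nra.
Qed.

Lemma sum_lnn_le X : \sum_(1 <= n < X.+1) lnn n <= X%:R * lnn X.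
Proof.
rewrite -[X in X%:R * _]subn0 -subSS -sumr_const_nat mulr_suml.
rewrite big_nat [leRHS]big_nat.
apply: ler_sum => i /andP[i1 iX]; rewrite mul1r; exact: lnn_le.
Qed.

Lemma ln2_ge : 1 / 2 <= lnn 2.
Proof.
have := @le_ln1Dx R (- (1 / 2)); rewrite (_ : 1 + _ = 2^-1); last by lra.
rewrite lnV ?posrE // => /(_ _); lra.
Qed.

Lemma ln4_ge : 1 <= lnn 4.
Proof. by have := ln2_ge; rewrite (_ : 4%N = 2 * 2)%N // lnnM //; lra. Qed.

(** Cross-multiplied, this is [n (ln (n + 1) - ln n) <= 1 <= ln n]; the threshold comes from
    [ln4_ge]. *)
Lemma lnn_div_decr n : (4 <= n)%N -> lnn n.+1 / n.+1%:R <= lnn n / n%:R.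
Proof.
move=> n4; have n0 : (0 < n)%N by lia.
have n0R : 0 < n%:R :> R by rewrite ltr0n.
rewrite ler_pdivrMr ?ltr0n // mulrAC ler_pdivlMr //.
have := lnnS_sub n0; have := lnn_le (isT : 0 < 4)%N n4; have := ln4_ge.
have : n.+1%:R = n%:R + 1 :> R by rewrite natr1.
move: (lnn 4) (lnn n.+1) (lnn n) (n.+1%:R : R) => e d c b ->; nra.
Qed.

(* Telescoping: (ln n + 2) / n decreases by at least ln n / n^2 at each step. *)
Lemma sum_lnn_sqr_le X : (0 < X)%N ->
  \sum_(1 <= n < X.+1) lnn n / n%:R ^+ 2 <= 2 - (lnn X + 2) / X%:R.
Proof.
elim: X => // X IH _; rewrite big_nat_recr //=.
case: X IH => [|X] IH; first by rewrite big_geq // ln1; lra.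
have {IH} := IH isT.
move: (\sum_(_ <= _ < _) _) => S; move: X.+1 (ltn0Sn X) => {X} x xgt0 IH.
have x0 : 0 < x%:R :> R by rewrite ltr0n.
have x1 : 1 <= x%:R :> R by rewrite ler1n.
suff : lnn x.+1 / x.+1%:R ^+ 2 <= (lnn x + 2) / x%:R - (lnn x.+1 + 2) / x.+1%:R.
  by move: (_ / _) (_ / x%:R) (_ / x.+1%:R) IH => ? ? ?; lra.
have h := lnnS_sub xgt0; have l0 := lnn_ge0 x.+1.
move: (lnn x.+1) (lnn x) h l0 => b a; rewrite -(natr1 x).
move: (x%:R : R) x0 x1 => y x0 x1 h l0.
have y0 : y + 1 != 0 by lra.
have y1 : y != 0 by lra.
have -> : (a + 2) / y - (b + 2) / (y + 1) =
  (b + (2 - (y + 1) * (b - a))) / (y * (y + 1)) by field; rewrite ?y0 ?y1.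
have h2 : (y + 1) * (b - a) <= 2.
  rewrite mulrDl mul1r; suff : b - a <= 1 by lra.
  have [|] := lerP (b - a) 0; [lra | nra].
have y2 : 0 < y + 1 by lra.
apply: (@le_trans _ _ (b / (y * (y + 1)))); last first.
  apply: ler_wpM2r; last by lra.
  by rewrite invr_ge0 mulr_ge0 //; lra.
apply: ler_wpM2l => //; rewrite lef_pV2 ?posrE ?mulr_gt0 ?exprn_gt0 //.
by rewrite expr2 ler_wpM2r; lra.
Qed.

Lemma sum_lnn_sqr_le2 X : \sum_(1 <= n < X.+1) lnn n / n%:R ^+ 2 <= 2.
Proof.
case: X => [|X]; first by rewrite big_geq.
apply: (le_trans (sum_lnn_sqr_le (isT : 0 < X.+1)%N)).
by rewrite gerBl divr_ge0 // addr_ge0 // lnn_ge0.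
Qed.

Lemma geometric_tail_le (p X : nat) : (1 < p)%N ->
  \sum_(2 <= k < X.+1) (p%:R ^+ k)^-1 <= 2 / p%:R ^+ 2 :> R.
Proof.
move=> p1; have p2 : 2 <= p%:R :> R by rewrite ler_nat.
have pV : p%:R^-1 <= 2^-1 :> R by rewrite lef_pV2 ?posrE; lra.
have pV0 : 0 < p%:R^-1 :> R by rewrite invr_gt0; lra.
(* The subtracted term closes the induction: for [p >= 2], [2 p^-(m+2) - 2 p^-(m+3)] is at least the
   new term [p^-(m+2)]. *)
suff h m : \sum_(2 <= k < m.+2) (p%:R ^+ k)^-1 <=
  2 / p%:R ^+ 2 - 2 * p%:R^-1 ^+ m.+2 :> R.
  case: X => [|X]; first by rewrite big_geq // divr_ge0 ?exprn_ge0; lra.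
  case: X => [|X]; first by rewrite big_geq // divr_ge0 ?exprn_ge0; lra.
  apply: (le_trans (h X.+1)); rewrite gerBl mulr_ge0 // exprn_ge0 // ltW //.
elim: m => [|m IH]; first by rewrite big_geq // exprVn subrr.
rewrite big_nat_recr //=; apply: (le_trans (lerD IH (lexx _))).
rewrite -addrA lerD2l -exprVn [_ ^+ m.+3]exprS.
have : 0 <= p%:R^-1 ^+ m.+2 :> R by rewrite exprn_ge0 // ltW.
by move: (_ ^+ m.+2) => z z0; nra.
Qed.

Lemma nat_sqrt_exists X : exists y, (y * y <= X < y.+1 * y.+1)%N.
Proof.
elim: X => [|X [y /andP[h1 h2]]]; first by exists 0%N.
have [h|h] := leqP (y.+1 * y.+1) X.+1; last by exists y; nia.
by exists y.+1; nia.
Qed.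

(** Rescale [ln t < t] to [t = e n]; the constant is [|ln e|]. *)
Lemma lnn_le_eps (e : R) : 0 < e -> exists2 c : R, 0 <= c &
  forall n, (0 < n)%N -> lnn n <= e * n%:R + c.
Proof.
move=> e0; exists `|ln e| => // n n0.
have n0R : 0 < n%:R :> R by rewrite ltr0n.
have := ln_sublinear (mulr_gt0 e0 n0R); rewrite lnM ?posrE //.
have := ler_norm (- ln e); rewrite normrN; lra.
Qed.

Lemma sign_eqE : ((1 == -1 :> R) = false) * ((-1 == 1 :> R) = false) *
  ((0 == -1 :> R) = false) * ((0 == 1 :> R) = false) *
  ((1 == 0 :> R) = false) * ((-1 == 0 :> R) = false).
Proof. by do !split; apply/eqP; lra. Qed.

End ElementaryEstimates.

(** * Chebyshev and Mertens bounds *)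

Section LogDecomposition.
Variable R : realType.

Local Notation lnn n := (ln (n%:R : R)).

(** This is [ln = 1 * Lambda], with von Mangoldt's function spelled out over prime powers; the
    common range [X] for [p] and [k] allows sums over [n] to be exchanged. *)
Lemma lnn_factor X n : (0 < n <= X)%N ->
  lnn n = \sum_(1 <= p < X.+1 | prime p)
            \sum_(1 <= k < X.+1 | (p ^ k %| n)%N) lnn p.
Proof.
move=> /andP[n0 nX].
have en : n = (\prod_(0 <= p < X.+1 | prime p) p ^ logn p n)%N.
  rewrite -{1}(partnT n0) (widen_partn predT nX) [LHS](bigID prime) /=.
  rewrite [X in (_ * X)%N]big1 ?muln1; first by [].
  by move=> p /negbTE; rewrite lognE => ->.
rewrite {1}en lnn_prod; last by move=> p /prime_gt0 p0; rewrite expn_gt0 p0.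
rewrite big_mkcond big_nat_recl //= add0r [RHS]big_mkcond /=.
rewrite (big_addn 0 X.+1 1) subn1 /=.
apply: eq_bigr => p _; rewrite addn1; case: ifP => // pp.
rewrite natrX lnXn ?ltr0n // logn_count_dvd //.
rewrite [RHS]big_mkcond /= -[LHS]mulr_natl natr_sum mulr_suml.
rewrite [RHS](big_cat_nat (n := n)) //=; last exact: leqW.
rewrite [X in _ + X]big_nat_cond [X in _ + X]big1 ?addr0.
  by apply: eq_bigr => k _; case: ifP => _; rewrite ?mul1r ?mul0r.
(* For [k >= n], [p ^ k > k >= n], so extending the range of [k] adds nothing. *)
move=> k /andP[/andP[nk _] _]; case: ifP => // /(dvdn_leq n0).
by rewrite leqNgt (leq_ltn_trans nk) // ltn_expl // prime_gt1.
Qed.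

Lemma sum_multiples (d X : nat) (g : nat -> R) : (0 < d)%N ->
  \sum_(1 <= n < X.+1 | (d %| n)%N) g n =
  \sum_(1 <= m < (X %/ d).+1) g (d * m)%N.
Proof.
move=> d0; elim: X => [|X IH]; first by rewrite div0n !big_geq.
rewrite big_mkcond big_nat_recr //= -big_mkcond /= IH divnS //.
case: ifPn => [dX|_]; last by rewrite addr0 add0n.
rewrite add1n [RHS]big_nat_recr //=; congr (_ + g _).
have <- : (X.+1 %/ d = (X %/ d).+1)%N by rewrite divnS // dX add1n.
by rewrite mulnC divnK.
Qed.

(** Insert [lnn_factor], exchange the sums and write the multiples of [p ^ k] as [p ^ k * m]. Used
    with [g = 1] for Mertens' estimates and with [g n = chi n / n] for their twisted form. *)
Lemma sum_mul_lnn X (g : nat -> R) :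
  \sum_(1 <= n < X.+1) g n * lnn n =
  \sum_(1 <= p < X.+1 | prime p) \sum_(1 <= k < X.+1)
    lnn p * \sum_(1 <= m < (X %/ p ^ k).+1) g (p ^ k * m)%N.
Proof.
transitivity (\sum_(1 <= n < X.+1) \sum_(1 <= p < X.+1 | prime p)
   \sum_(1 <= k < X.+1 | (p ^ k %| n)%N) g n * lnn p).
  rewrite big_nat [RHS]big_nat; apply: eq_bigr => n nX.
  rewrite (lnn_factor (X := X)) // mulr_sumr; apply: eq_bigr => p _.
  by rewrite mulr_sumr.
rewrite exchange_big /=; apply: eq_bigr => p pp.
transitivity (\sum_(1 <= n < X.+1) \sum_(1 <= k < X.+1)
   if (p ^ k %| n)%N then g n * lnn p else 0).
  by apply: eq_bigr => n _; rewrite big_mkcond.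
rewrite exchange_big /=; apply: eq_bigr => k _.
rewrite -big_mkcond /= sum_multiples ?expn_gt0 ?prime_gt0 //.
by rewrite mulr_sumr; apply: eq_bigr => m _; rewrite mulrC.
Qed.

(** Chebyshev's function, restricted to the primes in [P]. *)
Definition theta (P : pred nat) X : R :=
  \sum_(1 <= p < X.+1 | prime p && P p) lnn p.

Definition mertens (P : pred nat) X : R :=
  \sum_(1 <= p < X.+1 | prime p && P p) lnn p / p%:R.

(** Proper prime powers contribute [O(1)]: each geometric tail is at most [2 / p^2], and the sum of
    [2 ln n / n^2] over all integers is at most 4. *)
Lemma prime_power_tail_le X :
  \sum_(1 <= p < X.+1 | prime p) \sum_(2 <= k < X.+1) lnn p / p%:R ^+ k <= 4.
Proof.
apply: (@le_trans _ _ (\sum_(1 <= p < X.+1) 2 * (lnn p / p%:R ^+ 2))); last first.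
  by rewrite -mulr_sumr; have := @sum_lnn_sqr_le2 R X; lra.
rewrite big_mkcond; apply: ler_sum => p _; case: ifPn => pp; last first.
  by rewrite mulr_ge0 // divr_ge0 ?lnn_ge0 // exprn_ge0.
rewrite -mulr_sumr mulrCA; apply: ler_wpM2l; first exact: lnn_ge0.
exact: geometric_tail_le (prime_gt1 pp).
Qed.

(** * Chebyshev's upper bound through products of primes *)

Lemma prod_primes_dvd a b m :
  (forall p, prime p -> (a <= p < b)%N -> (p %| m)%N) ->
  (\prod_(a <= p < b | prime p) p %| m)%N.
Proof.
elim: b => [|b IH] h; first by rewrite big_geq // dvd1n.
have [ab|ba] := leqP a b; last by rewrite big_geq // dvd1n.
rewrite big_mkcond big_nat_recr //= -big_mkcond /=.
have {}IH : (\prod_(a <= p < b | prime p) p %| m)%N.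
  by apply: IH => p pp /andP[ap pb]; apply: h => //; rewrite ap ltnW.
case: ifPn => [pb|_]; last by rewrite muln1.
rewrite Gauss_dvd ?IH ?h ?ab //=.
rewrite big_nat_cond; apply: (big_ind (fun x => coprime x b)).
- exact: coprime1n.
- by move=> x y cx cy; rewrite coprimeMl cx.
- move=> p /andP[/andP[ap pltb] pp]; rewrite prime_coprime //.
  by rewrite dvdn_prime2 // neq_ltn pltb.
Qed.

(** The two equal middle coefficients of [(1 + 1) ^ (2m + 1)] add up to at most [2 * 4 ^ m]. *)
Lemma central_bin_le4 m : ('C(m.*2.+1, m) <= 4 ^ m)%N.
Proof.
rewrite -(leq_pmul2l (isT : 0 < 2)%N).
have -> : (2 * 4 ^ m = (1 + 1) ^ m.*2.+1)%N.
  by rewrite expnS -muln2 mulnC [in RHS]mulnC expnM expnAC.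
rewrite expnDn; under eq_bigr do rewrite !exp1n !muln1.
have m1 : (m < m.*2.+2)%N by lia.
have m2 : (m.+1 < m.*2.+2)%N by lia.
rewrite (bigD1 (Ordinal m1)) //= (bigD1 (Ordinal m2)) /=; last first.
  by rewrite -val_eqE /=; lia.
have <- : 'C(m.*2.+1, m) = 'C(m.*2.+1, m.+1).
  by rewrite -[LHS]bin_sub; [congr 'C(_, _); lia | lia].
by rewrite mul2n -addnn addnA leq_addr.
Qed.

(** Erdos' argument: for [n = 2m + 1] the primes above [m + 1] divide ['C(2m+1, m)], which is at
    most [4 ^ m], and induction handles the primes up to [m + 1]; an even [n > 2] is not prime. *)
Lemma prod_primes_le4 n : (\prod_(1 <= p < n.+1 | prime p) p <= 4 ^ n)%N.
Proof.
have [k] := ubnP n; elim: k n => // k IH n; rewrite ltnS => nk.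
case: n nk => [|[|[|n]]] nk.
- by rewrite unlock.
- by rewrite unlock.
- by rewrite unlock.
have [nodd|neven] := boolP (odd n.+3).
  have [m m0 en] : exists2 m, (0 < m)%N & n.+3 = m.*2.+1.
    by exists n.+3./2; [| rewrite -[LHS]odd_double_half nodd add1n].
  rewrite en (big_cat_nat (n := m.+2)) //=; last by rewrite !ltnS; lia.
  have -> : (4 ^ m.*2.+1 = 4 ^ m.+1 * 4 ^ m)%N.
    by rewrite -expnD; congr (4 ^ _)%N; lia.
  apply: leq_mul; first by apply: IH; lia.
  apply: (@leq_trans 'C(m.*2.+1, m)).
    apply: dvdn_leq; first by rewrite bin_gt0; lia.
    (* Such a [p] divides [(2m+1)!] but neither [m!] nor [(m+1)!]. *)
    have pr_dvd p : prime p -> (m.+2 <= p < m.*2.+2)%N -> (p %| 'C(m.*2.+1, m))%N.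
      move=> pp /andP[mp pm].
      have := bin_fact (_ : m <= m.*2.+1)%N => /(_ _) h.
      have {h} h : ('C(m.*2.+1, m) * (m`! * (m.+1)`!) = (m.*2.+1)`!)%N.
        have := h _; rewrite (_ : m.*2.+1 - m = m.+1)%N; first by apply; lia.
        by lia.
      have : (p %| (m.*2.+1)`!)%N by rewrite dvdn_fact // prime_gt0 //=; lia.
      have small j : (j <= m.+1)%N -> (p %| j`!)%N = false.
        elim: j => [|j IHj] jm; first by rewrite fact0 dvdn1; case: p pp {mp pm} => [|[]].
        rewrite factS Euclid_dvdM // IHj ?orbF; last by lia.
        by apply/negP => /dvdn_leq -/(_ isT); lia.
      rewrite -h Euclid_dvdM // => /orP[//|]; rewrite Euclid_dvdM //.
      by rewrite (small m) ?leqnSn // (small m.+1).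
    exact: prod_primes_dvd.
  exact: central_bin_le4.
rewrite big_mkcond big_nat_recr //= -big_mkcond /=.
rewrite ifF ?muln1; last first.
  by apply/negP => /even_prime[//|]; apply/negP.
by apply: (@leq_trans (4 ^ n.+2)); [apply: IH | rewrite leq_exp2l].
Qed.

Lemma theta_le X : theta predT X <= X%:R * lnn 4.
Proof.
rewrite /theta; under eq_bigl do rewrite andbT.
rewrite -lnn_prod; last by move=> p /prime_gt0.
have := prod_primes_le4 X; move/(@lnn_le R) => -/(_ _).
rewrite natrX lnXn ?ltr0n // mulr_natl; apply.
by apply: prodn_cond_gt0 => p /prime_gt0.
Qed.

(** * Mertens' estimate for the sum of [ln p / p] *)

Lemma mertens_ge0 P X : 0 <= mertens P X.
Proof. by apply: sumr_ge0 => p _; rewrite divr_ge0 ?lnn_ge0. Qed.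

(** Expand [ln X!] by [sum_mul_lnn] and bound each floor by [X / p^k]. The constant 5 is 1 from
    Stirling plus 4 from the proper prime powers. *)
Lemma mertens_lower X : (0 < X)%N -> lnn X - 5 <= mertens predT X.
Proof.
move=> X0; have X0R : 0 < X%:R :> R by rewrite ltr0n.
rewrite -(ler_pM2l X0R); have := sum_lnn_ge R X.
under eq_bigr do rewrite -[lnn _]mul1r.
rewrite sum_mul_lnn => h.
suff : \sum_(1 <= p < X.+1 | prime p) \sum_(1 <= k < X.+1)
    lnn p * \sum_(1 <= m < (X %/ p ^ k).+1) 1 <= X%:R * (mertens predT X + 4).
  by move=> /(le_trans h); clear; move: (mertens _ _) (lnn _) => ? ?; lra.
have := prime_power_tail_le X; move: X0 X0R {h}; case: X => // X _ X0R h.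
apply: (@le_trans _ _ (X.+1%:R * \sum_(1 <= p < X.+2 | prime p)
   \sum_(1 <= k < X.+2) lnn p / p%:R ^+ k)).
  rewrite mulr_sumr; apply: ler_sum => p pp; rewrite mulr_sumr; apply: ler_sum => k _.
  rewrite mulrCA; apply: ler_wpM2l; first exact: lnn_ge0.
  have pk0 : 0 < p%:R ^+ k :> R by rewrite exprn_gt0 // ltr0n prime_gt0.
  rewrite sumr_const_nat subn1 /= ler_pdivlMr // -natrX -natrM ler_nat.
  exact: leq_divM.
rewrite ler_pM2l //; under eq_bigr do rewrite big_ltn // expr1.
rewrite big_split /= /mertens; under [X in _ <= X + _]eq_bigl do rewrite andbT.
exact: lerD.
Qed.

(** Keep only [k = 1] in the same expansion; replacing [floor(X / p)] by [X / p] costs at most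
    [theta X <= X ln 4]. *)
Lemma mertens_upper X : (0 < X)%N -> mertens predT X <= lnn X + lnn 4.
Proof.
move=> X0; have X0R : 0 < X%:R :> R by rewrite ltr0n.
rewrite -(ler_pM2l X0R) mulrDr -lerBlDr.
apply: le_trans (sum_lnn_le R X).
under eq_bigr do rewrite -[lnn _]mul1r.
rewrite sum_mul_lnn.
apply: (@le_trans _ _ (X%:R * mertens predT X - theta predT X)).
  by rewrite lerD2l lerN2 theta_le.
rewrite /mertens /theta mulr_sumr -sumrB; under eq_bigl do rewrite andbT.
apply: ler_sum => p pp.
case: X X0 X0R => // X _ X0R.
rewrite big_ltn // expn1 sumr_const_nat subn1 /=.
apply: (@le_trans _ _ (lnn p * (X.+1 %/ p)%:R)).
  rewrite mulrCA -[X in _ - X]mulr1 -mulrBr; apply: ler_wpM2l; first exact: lnn_ge0.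
  have p0 : 0 < p%:R :> R by rewrite ltr0n prime_gt0.
  rewrite lerBlDr ler_pdivrMr // natr1 -natrM ler_nat ltnW //.
  by rewrite ltn_ceil // prime_gt0.
rewrite lerDl; apply: sumr_ge0 => k _; rewrite mulr_ge0 ?lnn_ge0 //.
by apply: sumr_ge0.
Qed.

(* The interval ]n/D, n] already carries a positive proportion of theta. *)
Lemma theta_linear_lower (P : pred nat) (kappa C : R) : 0 < kappa ->
  (forall X, (0 < X)%N -> `|mertens P X - kappa * lnn X| <= C) ->
  exists2 D : nat, (0 < D)%N &
    forall n, (D <= n)%N -> n%:R <= (2 * D)%:R * theta P n.
Proof.
move=> k0 hC.
have C0 : 0 <= C by apply: le_trans (hC 1%N isT).
(* With this [D], [kappa * ln D >= 2 C + 1], so the Mertens sum over []n/D, n]] is at least 1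
   whatever the errors at its two ends. *)
pose D := (Num.truncn (expR ((2 * C + 1) / kappa))).+1.
exists D => // n Dn.
pose m := (n %/ D)%N.
have m0 : (0 < m)%N by rewrite divn_gt0.
have n0 : (0 < n)%N by apply: leq_trans Dn.
have mn : (m <= n)%N by exact: leq_div.
have lD : (2 * C + 1) / kappa <= lnn D.
  rewrite -ler_expR lnK ?posrE ?ltr0n //.
  by apply: ltW; rewrite /D truncnS_gt.
have lnm : lnn D + lnn m <= lnn n.
  by rewrite -lnnM // lnn_le ?muln_gt0 ?m0 // mulnC leq_divM.
have hm : 1 <= mertens P n - mertens P m.
  have := hC n n0; have := hC m m0; rewrite !ler_norml => /andP[_ h1] /andP[h2 _].
  have : 2 * C + 1 <= kappa * (lnn n - lnn m).
    by rewrite -ler_pdivrMl // [leLHS]mulrC (le_trans lD) // lerBrDr.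
  by rewrite mulrBr; move: (kappa * lnn n) (kappa * lnn m) h1 h2 => ? ?; lra.
have mth : m%:R <= theta P n.
  apply: (@le_trans _ _ (m%:R * (mertens P n - mertens P m))).
    by rewrite ler_peMr.
  rewrite /mertens /theta (big_cat_nat (n := m.+1)) //= [X in X - _]addrC addrK.
  rewrite [leRHS](big_cat_nat (n := m.+1)) //=.
  rewrite mulr_sumr.
  apply: ler_wpDl; first by apply: sumr_ge0 => p _; exact: lnn_ge0.
  rewrite [leLHS]big_nat_cond [leRHS]big_nat_cond.
  apply: ler_sum => p /andP[/andP[mp pn] /andP[pp _]].
  rewrite mulrCA ler_piMr ?lnn_ge0 // ler_pdivrMr ?ltr0n ?prime_gt0 //.
  by rewrite mul1r ler_nat ltnW.
apply: (@le_trans _ _ ((2 * D)%:R * m%:R)); last by rewrite ler_wpM2l.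
rewrite -natrM ler_nat; have := ltn_ceil n (isT : 0 < D)%N; rewrite -/m; nia.
Qed.

End LogDecomposition.

(** * Inert primes of a quadratic character *)

Section QuadraticCharacter.
Variables (R : realType) (N : nat) (chi : nat -> R).
Hypothesis N_gt0 : (0 < N)%N.
Hypothesis chiM : forall m n, chi (m * n) = chi m * chi n.
Hypothesis chiDN : forall n, chi (n + N) = chi n.
Hypothesis chi_val : forall n, [\/ chi n = 1, chi n = 0 | chi n = -1].
Hypothesis chi_eq0 : forall n, (chi n == 0) = ~~ coprime n N.
Variable ninert : nat.
Hypothesis chi_ninert : chi ninert = -1.

Local Notation lnn n := (ln (n%:R : R)).

Lemma chi_norm_le1 n : `|chi n| <= 1.
Proof. by have [] := chi_val n => ->; rewrite ?normrN ?normr1 ?normr0. Qed.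

Lemma chi_modN n : chi (n %% N) = chi n.
Proof.
rewrite [in RHS](divn_eq n N); elim: (n %/ N)%N => [|k IH]; first by rewrite mul0n.
by rewrite mulSn -addnA addnC chiDN.
Qed.

(** Multiplication by [ninert] permutes the residues modulo [N] and changes the sign of [chi], so
    the sum is its own opposite. *)
Lemma chi_sum_period : \sum_(i < N) chi i = 0.
Proof.
have cop : coprime ninert N.
  by rewrite -[coprime _ _]negbK -chi_eq0 chi_ninert oppr_eq0 oner_eq0.
pose h (i : 'I_N) : 'I_N := Ordinal (ltn_pmod (ninert * i) N_gt0).
have hinj : injective h.
  have step (i j : nat) : (i <= j)%N -> (j < N)%N ->
      ninert * i = ninert * j %[mod N] -> i = j.
    move=> ij jN /esym/eqP; rewrite eqn_mod_dvd ?leq_mul // -mulnBr.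
    rewrite Gauss_dvdr; last by rewrite coprime_sym.
    by move/dvdn_leq; lia.
  move=> i j /(congr1 val) /= e; apply: val_inj => /=.
  have [ij|/ltnW ij] := leqP i j; first exact: step.
  by apply/esym/step.
have e : \sum_(i < N) chi i = - \sum_(i < N) chi i.
  rewrite {1}(reindex_inj hinj) /= -sumrN; apply: eq_bigr => i _.
  by rewrite chi_modN chiM chi_ninert mulN1r.
lra.
Qed.

(** Twice the period: a sum over an interval is a difference of two initial sums, each reducible to
    less than one period. *)
Definition chi_bound : R := (2 * N)%:R.

Lemma chi_sum_bound a b : (a <= b)%N -> `|\sum_(a <= n < b) chi n| <= chi_bound.
Proof.
pose P k := \sum_(0 <= n < k) chi n.
have Pmod k : P (k %% N)%N = P k.
  rewrite [in RHS](divn_eq k N); elim: (k %/ N)%N => [|j IH]; first by rewrite mul0n.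
  rewrite IH mulSn -addnA /P [RHS](big_cat_nat (n := N)) ?leq_addr //=.
  rewrite [X in _ = X + _]big_mkord chi_sum_period add0r.
  rewrite -[X in _ = \sum_(X <= _ < _) _]add0n [RHS]big_addn addKn.
  by apply: eq_bigr => i _; rewrite chiDN.
have Ple k : `|P k| <= N%:R.
  rewrite -Pmod; apply: le_trans (ler_norm_sum _ _ _) _.
  apply: (@le_trans _ _ (\sum_(0 <= n < k %% N) 1)).
    by apply: ler_sum => i _; exact: chi_norm_le1.
  by rewrite sumr_const_nat subn0 ler_nat ltnW // ltn_pmod.
move=> ab; have -> : \sum_(a <= n < b) chi n = P b - P a.
  by rewrite /P [X in _ = X - _](big_cat_nat (n := a)) //= addrAC subrr add0r.
rewrite /chi_bound mulSn mul1n natrD.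
by apply: le_trans (ler_normB _ _) _; apply: lerD.
Qed.

Lemma chi_bound_ge0 : 0 <= chi_bound. Proof. exact: ler0n. Qed.

(** Abel summation: the partial sums of [chi] are at most [chi_bound], and the nonnegative
    differences of [g], with the boundary term, telescope to [g a]. *)
Lemma dirichlet_test (g : nat -> R) a b : (a <= b)%N ->
  (forall n, (a <= n)%N -> 0 <= g n) ->
  (forall n, (a <= n)%N -> g n.+1 <= g n) ->
  `|\sum_(a <= n < b) chi n * g n| <= chi_bound * g a.
Proof.
move=> ab g0 gdecr.
pose T k := \sum_(a <= n < k) chi n.
have abel k : \sum_(a <= n < a + k) chi n * g n =
    T (a + k)%N * g (a + k)%N +
    \sum_(a <= n < a + k) T n.+1 * (g n - g n.+1).
  elim: k => [|k IH]; first by rewrite addn0 /T !big_geq // mul0r addr0.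
  rewrite addnS !big_nat_recr ?leq_addr //= IH.
  by rewrite /T big_nat_recr ?leq_addr //=; ring.
have tele k : \sum_(a <= n < a + k) (g n - g n.+1) = g a - g (a + k)%N.
  elim: k => [|k IH]; first by rewrite addn0 big_geq // subrr.
  by rewrite addnS big_nat_recr ?leq_addr //= IH; ring.
rewrite -(subnKC ab) abel.
apply: le_trans (ler_normD _ _) _.
have -> : chi_bound * g a = chi_bound * g (a + (b - a))%N +
   \sum_(a <= n < a + (b - a)) chi_bound * (g n - g n.+1).
  by rewrite -mulr_sumr tele; ring.
apply: lerD.
  rewrite normrM [X in _ * X]ger0_norm; last by rewrite g0 ?leq_addr.
  by rewrite ler_wpM2r ?g0 ?leq_addr // chi_sum_bound ?leq_addr.
apply: le_trans (ler_norm_sum _ _ _) _.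
rewrite big_nat [leRHS]big_nat; apply: ler_sum => n /andP[an _].
have d0 : 0 <= g n - g n.+1 by rewrite subr_ge0 gdecr.
rewrite normrM [X in _ * X]ger0_norm // ler_wpM2r //.
by rewrite chi_sum_bound // leqW.
Qed.

(** * The series [chi n / n] and Mertens' estimate twisted by [chi] *)

Definition Lsum X : R := \sum_(1 <= n < X.+1) chi n / n%:R.

Lemma Lsum_cauchy X Y : (X <= Y)%N -> `|Lsum Y - Lsum X| <= chi_bound / X.+1%:R.
Proof.
move=> XY; rewrite /Lsum (big_cat_nat (n := X.+1)) //= addrAC subrr add0r.
apply: (dirichlet_test (g := fun n => n%:R^-1)) => // n Xn.
by rewrite lef_pV2 ?posrE ?ltr0n ?ler_nat // (leq_ltn_trans _ Xn).
Qed.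

Lemma Lsum_bound X : `|Lsum X| <= chi_bound.
Proof.
have := @Lsum_cauchy 0 X isT.
by rewrite {2}/Lsum big_geq // subr0 divr1.
Qed.

(** The limit is taken as the supremum of the lower bounds [Lsum X - chi_bound / (X + 1)]: by
    [Lsum_cauchy] each lies below every [Lsum Y + chi_bound / (Y + 1)], which gives the rate at
    once. *)
Lemma Lsum_limit : exists L : R, forall X, `|Lsum X - L| <= chi_bound / X.+1%:R.
Proof.
pose E := range (fun X => Lsum X - chi_bound / X.+1%:R).
have Eub Y : ubound E (Lsum Y + chi_bound / Y.+1%:R).
  move=> _ [X _ <-]; rewrite lerBlDr.
  have bX n : 0 <= chi_bound / n.+1%:R by rewrite divr_ge0 ?chi_bound_ge0.
  have := bX X; have := bX Y.
  have [XY|/ltnW YX] := leqP X Y.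
    have := Lsum_cauchy XY; rewrite ler_norml => /andP[].
    by move: (chi_bound / _) (chi_bound / _) => ? ?; lra.
  have := Lsum_cauchy YX; rewrite ler_norml => /andP[].
  by move: (chi_bound / _) (chi_bound / _) => ? ?; lra.
have E0 : E !=set0 by exists (Lsum 0 - chi_bound / 1%:R); exists 0%N.
have hE : has_sup E by split=> //; exists (Lsum 0 + chi_bound / 1%:R); exact: Eub.
exists (sup E) => X; rewrite ler_distlC; apply/andP; split.
  by apply: sup_upper_bound => //; exists X.
by apply: ge_sup.
Qed.

Lemma chi_log_sum_bounded : exists C : R, forall X,
  `|\sum_(1 <= n < X.+1) chi n / n%:R * lnn n| <= C.
Proof.
pose g n : R := lnn n / n%:R.
have eg n : chi n / n%:R * lnn n = chi n * g n by rewrite mulrAC mulrA.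
(* Monotonicity of [ln n / n] is available from 4 on; earlier terms are bounded separately. *)
pose C0 : R := \sum_(1 <= n < 4) `|chi n * g n|.
exists (C0 + chi_bound * g 4) => X.
under eq_bigr do rewrite eg.
have gpos n : 0 <= g n by rewrite divr_ge0 ?lnn_ge0.
have [X4|X4] := leqP X.+1 4.
  apply: le_trans (ler_norm_sum _ _ _) _.
  rewrite /C0 (big_cat_nat (m := 1) (n := X.+1) (p := 4)) //= -addrA lerDl.
  apply: addr_ge0; first by apply: sumr_ge0 => n _; exact: normr_ge0.
  by rewrite mulr_ge0 ?chi_bound_ge0.
rewrite (big_cat_nat (n := 4)) //=; last exact: ltnW.
apply: le_trans (ler_normD _ _) _; apply: lerD; first exact: ler_norm_sum.
apply: dirichlet_test; [exact: ltnW | by move=> n _; exact: gpos | move=> n n4].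
exact: lnn_div_decr.
Qed.

Definition chi_mertens X : R :=
  \sum_(1 <= p < X.+1 | prime p) lnn p * (chi p / p%:R).

(** Expand [ln] in [chi_log_sum_bounded] by [sum_mul_lnn]: multiplicativity pulls out
    [chi (p^k) / p^k] and leaves [Lsum (X / p^k)]. The terms with [k >= 2] are absorbed by
    [prime_power_tail_le]. *)
Lemma chi_prime_sum_bounded : exists C : R, forall X,
  `|\sum_(1 <= p < X.+1 | prime p) lnn p * (chi p / p%:R * Lsum (X %/ p))| <= C.
Proof.
have [C hC] := chi_log_sum_bounded; exists (C + chi_bound * 4) => X.
have := hC X; rewrite sum_mul_lnn.
have inner p k : prime p ->
   \sum_(1 <= m < (X %/ p ^ k).+1) chi (p ^ k * m)%N / (p ^ k * m)%:R = chi (p ^ k)%N / (p ^ k)%:R * Lsum (X %/ p ^ k).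
  move=> pp; rewrite /Lsum mulr_sumr; apply: eq_bigr => m _.
  by rewrite chiM natrM invfM mulrACA.
case: X inner => [|X] inner.
  by rewrite !big_geq // !normr0 => C0; rewrite addr_ge0 ?mulr_ge0 ?chi_bound_ge0.
rewrite (eq_bigr (fun p => lnn p * (chi p / p%:R * Lsum (X.+1 %/ p)) +
   \sum_(2 <= k < X.+2)
     lnn p * (chi (p ^ k)%N / (p ^ k)%:R * Lsum (X.+1 %/ p ^ k)))); last first.
  move=> p pp; rewrite big_ltn // inner // expn1; congr (_ + _).
  by apply: eq_bigr => k _; rewrite inner.
rewrite big_split /=; set S1 := (X in `|X| <= _ + _); set S2 := (X in _ + X) => h.
have -> : S1 = (S1 + S2) - S2 by rewrite addrK.
apply: le_trans (ler_normB _ _) _; apply: lerD => //.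
apply: le_trans (ler_norm_sum _ _ _) _.
apply: le_trans (ler_wpM2l chi_bound_ge0 (@prime_power_tail_le R X.+1)).
rewrite mulr_sumr; apply: ler_sum => p pp; rewrite mulr_sumr.
apply: le_trans (ler_norm_sum _ _ _) _; apply: ler_sum => k _.
rewrite [leRHS]mulrCA normrM ger0_norm ?lnn_ge0 //.
apply: ler_wpM2l; first exact: lnn_ge0.
rewrite mulrC normrM; apply: ler_pM => //; first exact: Lsum_bound.
rewrite normrM normfV natrX [X in _ / X]ger0_norm ?exprn_ge0 //.
rewrite -[leRHS]mul1r ler_wpM2r ?chi_norm_le1 // invr_ge0 exprn_ge0 //.
Qed.

(** Replace [Lsum (X / p)] by [L] in the preceding sum: the error at [p] is at most
    [chi_bound * ln p / X], in total [chi_bound * theta X / X = O(1)]. Then divide by [L]. *)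
Lemma chi_mertens_bounded (L : R) : L != 0 ->
  (forall X, `|Lsum X - L| <= chi_bound / X.+1%:R) ->
  exists C : R, forall X, (0 < X)%N -> `|chi_mertens X| <= C.
Proof.
move=> L0 hL; have [C hC] := chi_prime_sum_bounded.
exists ((C + chi_bound * lnn 4) / `|L|) => X X0.
have X0R : 0 < X%:R :> R by rewrite ltr0n.
rewrite ler_pdivlMr ?normr_gt0 // -normrM.
set S := \sum_(1 <= p < X.+1 | prime p) lnn p * (chi p / p%:R * Lsum (X %/ p)).
have -> : chi_mertens X * L = S - \sum_(1 <= p < X.+1 | prime p)
     lnn p * (chi p / p%:R * (Lsum (X %/ p) - L)).
  rewrite /chi_mertens mulr_suml /S -sumrB; apply: eq_bigr => p _; ring.
apply: le_trans (ler_normB _ _) _; apply: lerD; first exact: hC.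
apply: le_trans (ler_norm_sum _ _ _) _.
apply: (@le_trans _ _ (chi_bound / X%:R * theta R predT X)); last first.
  rewrite -mulrA ler_wpM2l ?chi_bound_ge0 // ler_pdivrMl //.
  exact: theta_le.
rewrite /theta mulr_sumr; under [leRHS]eq_bigl do rewrite andbT.
apply: ler_sum => p pp.
have p0 : 0 < p%:R :> R by rewrite ltr0n prime_gt0.
rewrite normrM ger0_norm ?lnn_ge0 // mulrC; apply: ler_wpM2r; first exact: lnn_ge0.
rewrite normrM normrM normfV [X in _ / X]ger0_norm //.
apply: (@le_trans _ _ (p%:R^-1 * (chi_bound / (X %/ p).+1%:R))).
  apply: ler_pM => //; rewrite ?hL // -[leRHS]mul1r.
  by rewrite ler_wpM2r ?chi_norm_le1 // invr_ge0.
rewrite mulrCA; apply: ler_wpM2l; first exact: chi_bound_ge0.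
rewrite -[leLHS]invfM -natrM lef_pV2 ?posrE ?ltr0n ?muln_gt0 ?(prime_gt0 pp) //.
rewrite ler_nat mulnC.
by rewrite ltnW // ltn_ceil // prime_gt0.
Qed.


(** * The convolution [1 * chi] and its partial sums when the series sums to 0 *)

Definition chi_conv n : R := \sum_(1 <= d < n.+1 | (d %| n)%N) chi d.

Lemma chi1 : chi 1 = 1.
Proof.
have c0 : chi 1 != 0 by rewrite chi_eq0 negbK coprime1n.
by apply: (mulfI c0); rewrite -chiM mulr1.
Qed.

Lemma chi_conv1 : chi_conv 1 = 1.
Proof. by rewrite /chi_conv big_mkcond big_nat1 /= chi1. Qed.

(** The divisors of [p ^ k.+1 * m] prime to [p] are those of [m]; the others are [p * d] with [d]
    dividing [p ^ k * m]. *)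
Lemma chi_conv_rec p k m : prime p -> (0 < m)%N -> ~~ (p %| m)%N ->
  chi_conv (p ^ k.+1 * m) = chi_conv m + chi p * chi_conv (p ^ k * m).
Proof.
move=> pp m0 pm; have p0 := prime_gt0 pp.
have en : (p ^ k.+1 * m = p * (p ^ k * m))%N by rewrite expnS mulnA.
rewrite {1}/chi_conv (bigID (fun d => p %| d)%N) /= addrC; congr (_ + _).
  transitivity (\sum_(1 <= d < (p ^ k.+1 * m).+1 | (d %| m)%N) chi d).
    apply: eq_bigl => d; case: (boolP (p %| d)%N) => pd /=.
      rewrite andbF; apply/esym/negbTE.
      by apply: contra pm; apply: dvdn_trans.
    rewrite andbT Gauss_dvdr // coprime_sym coprimeXl //.
    by rewrite prime_coprime.
  rewrite (big_cat_nat (n := m.+1)) //=; last by rewrite ltnS leq_pmull // expn_gt0 p0.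
  rewrite [X in _ + X]big_nat_cond [X in _ + X]big1 ?addr0 //.
  by move=> d /andP[/andP[md _] /(dvdn_leq m0)]; rewrite leqNgt md.
pose g d : R := if (d %| p ^ k.+1 * m)%N then chi d else 0.
transitivity (\sum_(1 <= d < (p ^ k.+1 * m).+1 | (p %| d)%N) g d).
  rewrite big_mkcond [RHS]big_mkcond; apply: eq_bigr => d _; rewrite /g.
  by case: (p %| d)%N; rewrite ?andbT ?andbF.
rewrite sum_multiples // en mulKn // mulr_sumr [RHS]big_mkcond.
apply: eq_bigr => d _; rewrite /g en dvdn_pmul2l //.
by rewrite chiM.
Qed.

(** Strong induction on [n], stripping off the full power of its least prime factor. *)
Lemma chi_conv_ge0 n : (0 < n)%N -> 0 <= chi_conv n.
Proof.
have [b] := ubnP n; elim: b n => // b IH n nb n0.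
have [n1|n1] := leqP n 1.
  by rewrite (_ : n = 1)%N ?chi_conv1 //; lia.
set p := pdiv n; have pp : prime p := pdiv_prime n1.
have [m pm en] := pfactor_coprime pp n0.
have pm' : ~~ (p %| m)%N by rewrite -prime_coprime.
have m0 : (0 < m)%N by move: n0; rewrite en muln_gt0 => /andP[].
have hm : 0 <= chi_conv m.
  have mn : (m < n)%N.
    by rewrite en ltn_Pmulr // -(expn0 p) ltn_exp2l ?prime_gt1 // logn_gt0 pi_pdiv.
  by apply: IH => //; exact: leq_trans mn _.
rewrite en mulnC; move: (logn p n) => k.
(* When [chi p = -1] the recursion subtracts, so the induction on [k] must also carry an upper bound
   by [chi_conv m]. *)
suff : 0 <= chi_conv (p ^ k * m) /\ (chi p = -1 -> chi_conv (p ^ k * m) <= chi_conv m).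
  by case.
elim: k => [|k [IH1 IH2]]; first by rewrite mul1n.
rewrite chi_conv_rec //; have [cp|cp|cp] := chi_val p; rewrite cp.
- by rewrite mul1r; split; [rewrite addr_ge0 | lra].
- by rewrite mul0r addr0; split.
- by rewrite mulN1r subr_ge0 gerBl; split=> //; exact: IH2.
Qed.

Lemma chi_conv_prime p : prime p -> chi p = 1 -> chi_conv p = 2.
Proof.
move=> pp cp; have := @chi_conv_rec p 0 1 pp isT.
rewrite dvdn1 expn1 expn0 !muln1 chi_conv1 cp => ->; last by case: p pp {cp} => [|[]].
by lra.
Qed.

Lemma sum_chi_conv X :
  \sum_(1 <= n < X.+1) chi_conv n = \sum_(1 <= d < X.+1) chi d * (X %/ d)%:R.
Proof.
transitivity (\sum_(1 <= n < X.+1) \sum_(1 <= d < X.+1)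
    if (d %| n)%N then chi d else 0).
  rewrite big_nat [RHS]big_nat; apply: eq_bigr => n /andP[n0 nX].
  rewrite -big_mkcond /chi_conv [RHS](big_cat_nat (n := n.+1)) //=.
  rewrite [X in _ = _ + X]big_nat_cond [X in _ = _ + X]big1 ?addr0 //.
  by move=> d /andP[/andP[nd _] /(dvdn_leq n0)]; rewrite leqNgt nd.
rewrite exchange_big /= big_nat [RHS]big_nat; apply: eq_bigr => d /andP[d0 _].
rewrite -big_mkcond /= (sum_multiples _ (fun=> chi d)) // sumr_const_nat subn1 /=.
by rewrite mulr_natr.
Qed.

(** Split at [y = floor(sqrt X)]. For [d <= y], [floor(X / d)] is [X / d] up to 1, with main term
    [X * Lsum y], small because the series sums to 0. For [d > y], [floor(X / d)] is nonincreasing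
    and [dirichlet_test] applies. *)
Lemma sum_chi_conv_le : (forall X, `|Lsum X| <= chi_bound / X.+1%:R) ->
  forall X y, (y * y <= X < y.+1 * y.+1)%N ->
    \sum_(1 <= n < X.+1) chi_conv n <= (2 * chi_bound + 1) * y.+1%:R.
Proof.
move=> hL X y /andP[yX Xy].
have yleX : (y <= X)%N by nia.
rewrite sum_chi_conv (big_cat_nat (n := y.+1)) //=.
have y1 : 0 < y.+1%:R :> R by rewrite ltr0n.
have h2 : `|\sum_(y.+1 <= d < X.+1) chi d * (X %/ d)%:R| <= chi_bound * y.+1%:R.
  apply: le_trans (dirichlet_test (g := fun d => (X %/ d)%:R) _ _ _) _ => //.
  - by move=> d yd; rewrite ler_nat leq_div2l //; exact: leq_ltn_trans yd.
  - rewrite ler_wpM2l ?chi_bound_ge0 // ler_nat.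
    by rewrite -ltnS ltn_divLR //; apply: (leq_trans Xy); rewrite leq_mul.
have h1 : `|\sum_(1 <= d < y.+1) chi d * (X %/ d)%:R| <=
    chi_bound * y.+1%:R + y.+1%:R.
  have -> : \sum_(1 <= d < y.+1) chi d * (X %/ d)%:R = X%:R * Lsum y -
      \sum_(1 <= d < y.+1) chi d * (X%:R / d%:R - (X %/ d)%:R).
    rewrite /Lsum mulr_sumr -sumrB; apply: eq_bigr => d _; ring.
  apply: le_trans (ler_normB _ _) _; apply: lerD.
    rewrite normrM ger0_norm //.
    apply: le_trans (ler_wpM2l _ (hL y)) _ => //.
    rewrite mulrCA ler_wpM2l ?chi_bound_ge0 // ler_pdivrMr //.
    by rewrite -natrM ler_nat ltnW.
  apply: le_trans (ler_norm_sum _ _ _) _.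
  apply: (@le_trans _ _ (\sum_(1 <= d < y.+1) 1)); last first.
    by rewrite sumr_const_nat ler_nat subn1.
  rewrite big_nat [leRHS]big_nat; apply: ler_sum => d /andP[d0 _].
  have d0R : 0 < d%:R :> R by rewrite ltr0n.
  rewrite normrM -[leRHS]mulr1; apply: ler_pM => //; first exact: chi_norm_le1.
  rewrite ger0_norm; last first.
    by rewrite subr_ge0 ler_pdivlMr // -natrM ler_nat leq_divM.
  rewrite lerBlDr ler_pdivrMr // nat1r -natrM ler_nat ltnW // ltn_ceil //.
have := ler_norm (\sum_(1 <= d < y.+1) chi d * (X %/ d)%:R).
have := ler_norm (\sum_(y.+1 <= d < X.+1) chi d * (X %/ d)%:R).
move: (\sum_(1 <= d < y.+1) _) (\sum_(y.+1 <= d < X.+1) _) h1 h2 => S1 S2; lra.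
Qed.

(** A prime with [chi p = 1] has [chi_conv p = 2], and the other terms are nonnegative. *)
Lemma theta_split_le X :
  theta R (fun p => chi p == 1) X <= lnn X * \sum_(1 <= n < X.+1) chi_conv n.
Proof.
rewrite /theta mulr_sumr big_mkcond big_nat [leRHS]big_nat.
apply: ler_sum => p /andP[p0 pX].
have c0 := chi_conv_ge0 p0; have l0 := lnn_ge0 R X.
case: ifPn => [/andP[pp /eqP cp]|_]; last exact: mulr_ge0.
rewrite chi_conv_prime //; have := lnn_le R p0 (pX : (p <= X)%N); lra.
Qed.

(** [chi p = 0] forces [p] to divide [N], whence a bound independent of [X]. *)
Lemma ramified_sum_le (g : nat -> R) X : (forall p, 0 <= g p) ->
  \sum_(1 <= p < X.+1 | prime p && (chi p == 0)) g p <= \sum_(1 <= p < N.+1) g p.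
Proof.
move=> g0.
have pN p : prime p -> chi p == 0 -> (p <= N)%N.
  by move=> pp; rewrite chi_eq0 prime_coprime // negbK => /dvdn_leq; apply.
have [XN|NX] := leqP X N.
  rewrite (big_cat_nat (n := X.+1) (p := N.+1)) //= big_mkcond.
  apply: ler_wpDr; first exact: sumr_ge0.
  by apply: ler_sum => p _; case: ifP.
rewrite (big_cat_nat (n := N.+1)) //=; last exact: ltnW.
rewrite [X in _ + X]big_nat_cond [X in _ + X]big1 ?addr0.
  by rewrite big_mkcond; apply: ler_sum => p _; case: ifP.
move=> p /andP[/andP[Np _] /andP[pp /(pN _ pp)]]; by rewrite leqNgt Np.
Qed.

Local Notation inert := (fun p => chi p == -1).

Lemma theta_partition X : theta R predT X =
  theta R inert X + theta R (fun p => chi p == 1) X + theta R (fun p => chi p == 0) X.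
Proof.
rewrite /theta [in LHS]big_mkcond [X in _ = X + _ + _]big_mkcond.
rewrite [X in _ = _ + X + _]big_mkcond [X in _ = _ + X]big_mkcond.
rewrite -!big_split; apply: eq_bigr => p _ /=.
case: (prime p) => /=; last by rewrite !addr0.
have [->|->|->] := chi_val p.
- by rewrite eqxx !(sign_eqE R) add0r addr0.
- by rewrite eqxx !(sign_eqE R) !add0r.
- by rewrite eqxx !(sign_eqE R) !addr0.
Qed.

Lemma theta_inert_linear_lower : exists c : R, exists n1 : nat,
  0 < c /\ forall n, (n1 <= n)%N -> c * n%:R <= theta R inert n.
Proof.
have [L hL] := Lsum_limit.
have ln4 : 0 <= lnn 4 by exact: lnn_ge0.
have [L0|L0] := eqVneq L 0; last first.
  have [C hC] := chi_mertens_bounded L0 hL.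
  pose c0 : R := \sum_(1 <= p < N.+1) lnn p / p%:R.
  have c0_ge0 : 0 <= c0 by apply: sumr_ge0 => p _; rewrite divr_ge0 ?lnn_ge0.
  have h X : (0 < X)%N ->
      `|mertens R inert X - 2^-1 * lnn X| <= 5 + lnn 4 + C + c0.
    move=> X0; have := hC X X0; rewrite ler_norml => /andP[h1 h2].
    have h3 := mertens_lower R X0; have h4 := mertens_upper R X0.
    have h5 : mertens R (fun p => chi p == 0) X <= c0.
      by apply: ramified_sum_le => p; rewrite divr_ge0 ?lnn_ge0.
    have h6 := mertens_ge0 R (fun p => chi p == 0) X.
    (* Pointwise, twice the indicator of [chi p = -1] is [1 - chi p] minus the indicator of
       [chi p = 0]. *)
    have : 2 * mertens R inert X =
        mertens R predT X - chi_mertens X - mertens R (fun p => chi p == 0) X.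
      rewrite /mertens /chi_mertens mulr_sumr [in LHS]big_mkcond.
      rewrite [X in _ = X - _ - _]big_mkcond [X in _ = _ - X - _]big_mkcond.
      rewrite [X in _ = _ - X]big_mkcond -!sumrB.
      apply: eq_bigr => p _; case: (prime p) => /=; last by rewrite !subr0.
      have [->|->|->] := chi_val p.
      - by rewrite !(sign_eqE R); ring.
      - by rewrite eqxx !(sign_eqE R); ring.
      - by rewrite eqxx !(sign_eqE R); ring.
    move=> e; rewrite ler_norml; clearbody c0; clear hL hC.
    by apply/andP; split; lra.
  have half0 : 0 < 2^-1 :> R by rewrite invr_gt0.
  have [D D0 hD] := theta_linear_lower half0 h.
  exists ((2 * D)%:R^-1), D; split; first by rewrite invr_gt0 ltr0n muln_gt0.
  move=> n Dn; rewrite ler_pdivrMl ?ltr0n ?muln_gt0 //; exact: hD.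
(* From here on [L = 0]. Mertens for all primes gives [theta n >= n / (2 D)]; the primes with
   [chi p = 1] or [chi p = 0] will take at most half of it. *)
have hall X : (0 < X)%N -> `|mertens R predT X - 1 * lnn X| <= 5 + lnn 4.
  move=> X0; have := mertens_lower R X0; have := mertens_upper R X0.
  by rewrite mul1r ler_norml => ? ?; apply/andP; split; lra.
have [D D0 hD] := theta_linear_lower ltr01 hall.
have D0R : 0 < D%:R :> R by rewrite ltr0n.
pose C := 2 * chi_bound + 1; pose tz : R := \sum_(1 <= p < N.+1) lnn p.
have C0 : 0 < C by have := chi_bound_ge0; rewrite /C; lra.
have tz0 : 0 <= tz by apply: sumr_ge0 => p _; exact: lnn_ge0.
(* The primes with [chi p = 1] contribute at most [C (y + 1) ln n], [y] about [sqrt n], and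
   [ln n <= 2 (e (y + 1) + ce)]. This [e] keeps the quadratic term below [n / (8 D)]; the condition
   [y >= y1] does the same for the rest. *)
pose e : R := (64 * C * D%:R)^-1.
have e0 : 0 < e by rewrite invr_gt0 !mulr_gt0.
have [ce ce0 hce] := lnn_le_eps e0.
pose y1 := (Num.truncn (8 * D%:R * (4 * C * ce + tz))).+1.
exists ((4 * D)%:R^-1), (maxn D (y1.+1 * y1.+1)).
split; first by rewrite invr_gt0 ltr0n muln_gt0.
move=> n; rewrite geq_max => /andP[Dn yn].
have [y hy] := nat_sqrt_exists n; have /andP[hy1 hy2] := hy.
have y1y : (y1 <= y)%N by nia.
have y0 : (0 < y)%N by apply: leq_trans y1y.
have n0 : (0 < n)%N by apply: leq_trans Dn.
have hsp : theta R (fun p => chi p == 1) n <= lnn n * (C * y.+1%:R).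
  apply: le_trans (theta_split_le n) _; apply: ler_wpM2l; first exact: lnn_ge0.
  by apply: sum_chi_conv_le hy => X; have := hL X; rewrite L0 subr0.
have hz : theta R (fun p => chi p == 0) n <= tz.
  by apply: ramified_sum_le => p; exact: lnn_ge0.
have hln : lnn n <= 2 * (e * y.+1%:R + ce).
  apply: (@le_trans _ _ (lnn (y.+1 * y.+1))); first exact: lnn_le n0 (ltnW hy2).
  by rewrite lnnM //; have := hce y.+1 isT; lra.
have y1R : 8 * D%:R * (4 * C * ce + tz) <= y%:R.
  apply: le_trans (ltW (truncnS_gt _)) _; by rewrite ler_nat.
have hynR : y%:R * y%:R <= n%:R :> R by rewrite -natrM ler_nat.
have y1' : 1 <= y%:R :> R by rewrite ler1n.
have e1 : 8 * C * e = (8 * D%:R)^-1.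
  rewrite /e; field; rewrite ?gt_eqF //.
have hmain := hD n Dn; rewrite theta_partition in hmain.
rewrite natrM in hmain *.
rewrite ler_pdivrMl ?ltr0n ?muln_gt0 //.
have ySR : y.+1%:R <= 2 * y%:R :> R.
  by rewrite -natrM ler_nat mul2n -addnn -addn1 leq_add2l.
have b1 : lnn n * (C * y.+1%:R) <= 2 * (e * (2 * y%:R) + ce) * (C * (2 * y%:R)).
  apply: ler_pM; rewrite ?lnn_ge0 ?mulr_ge0 ?(ltW C0) //.
    by apply: le_trans hln _; rewrite ler_wpM2l // lerD2r ler_wpM2l // ltW.
  by rewrite ler_wpM2l // ltW.
have b2 : 8 * D%:R * (2 * (e * (2 * y%:R) + ce) * (C * (2 * y%:R)) + tz) <= 2 * n%:R.
  have e1' : 8 * D%:R * (8 * C * e) = 1 by rewrite e1 divff // gt_eqF // mulr_gt0.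
  have -> : 8 * D%:R * (2 * (e * (2 * y%:R) + ce) * (C * (2 * y%:R)) + tz) =
    (8 * D%:R * (8 * C * e)) * (y%:R * y%:R) + 8 * D%:R * (4 * C * ce) * y%:R +
    8 * D%:R * tz by ring.
  rewrite e1' mul1r.
  have : 8 * D%:R * (4 * C * ce + tz) * y%:R <= y%:R * y%:R by rewrite ler_wpM2r.
  have : 0 <= 8 * D%:R * tz * (y%:R - 1) by rewrite !mulr_ge0 // subr_ge0.
  lra.
have : D%:R * (theta R (fun p => chi p == 1) n + theta R (fun p => chi p == 0) n)
  <= D%:R * (2 * (e * (2 * y%:R) + ce) * (C * (2 * y%:R)) + tz).
  by rewrite ler_wpM2l ?(ltW D0R) // lerD // (le_trans hsp).
move: (theta R inert n) (theta R _ n) (theta R _ n) hmain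
  (2 * (e * (2 * y%:R) + ce) * _) b2 => t1 t2 t3 hmain w b2; lra.
Qed.

End QuadraticCharacter.

(** * Lower density *)

Section PrimeDensity.
Variable R : realType.

Local Notation lnn n := (ln (n%:R : R)).

Lemma prime_countE (P : set nat) n :
  prime_count P n = (\sum_(0 <= p < n.+1) (prime p && `[< P p >]))%N.
Proof.
rewrite /prime_count -sum1_count big_mkcond /index_iota subn0.
by apply: eq_bigr => p _; case: (_ && _).
Qed.

(** Split at [y = floor(sqrt n)]: at most [y] primes lie below, and each larger one has
    [ln p >= ln (y + 1) >= (ln n) / 2], so Chebyshev's bound counts them. *)
Lemma prime_count_upper n : (1 < n)%N ->
  (prime_count setT n)%:R * lnn n <= (4 + 2 * lnn 4) * n%:R.
Proof.
move=> n1; have n0 : (0 < n)%N by lia.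
have [y /andP[hy1 hy2]] := nat_sqrt_exists n.
have y0 : (0 < y)%N by case: y hy1 hy2 => // _; lia.
have yn : (y <= n)%N by nia.
have lnn_y : lnn n <= 2 * lnn y.+1.
  apply: (@le_trans _ _ (lnn (y.+1 * y.+1))); first exact: lnn_le n0 (ltnW hy2).
  by rewrite lnnM //; lra.
have ly : lnn y.+1 <= y.+1%:R by apply/ltW/ln_sublinear; rewrite ltr0n.
have l1 : 0 <= lnn n by exact: lnn_ge0.
have l2 : 0 <= lnn y.+1 by exact: lnn_ge0.
have hcnt : (prime_count setT n)%:R <=
   y%:R + \sum_(y.+1 <= p < n.+1 | prime p) 1 :> R.
  rewrite prime_countE natr_sum (big_cat_nat (n := y.+1)) //=; apply: lerD.
    rewrite big_ltn //= add0r.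
    apply: (@le_trans _ _ (\sum_(1 <= p < y.+1) 1)).
      by apply: ler_sum => p _; rewrite lern1 leq_b1.
    by rewrite sumr_const_nat subn1.
  rewrite [leRHS]big_mkcond; apply: ler_sum => p _.
  by case: (prime p) => //=; rewrite lern1 leq_b1.
have hth : (\sum_(y.+1 <= p < n.+1 | prime p) 1) * lnn y.+1 <= n%:R * lnn 4.
  apply: le_trans (theta_le R n); rewrite /theta mulr_suml.
  rewrite [leRHS](big_cat_nat (n := y.+1)) //=.
  apply: ler_wpDl; first by apply: sumr_ge0 => p _; exact: lnn_ge0.
  under [leRHS]eq_bigl do rewrite andbT.
  rewrite [leLHS]big_nat_cond [leRHS]big_nat_cond.
  by apply: ler_sum => p /andP[/andP[yp _] _]; rewrite mul1r lnn_le.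
have hyn : y%:R * y%:R <= n%:R :> R by rewrite -natrM ler_nat.
have hyS : y.+1%:R <= 2 * y%:R :> R by rewrite -natrM ler_nat; lia.
have y0R : 0 <= y%:R :> R by [].
set S := \sum_(_ <= _ < _ | _) _ in hcnt hth.
have S0 : 0 <= S by apply: sumr_ge0.
apply: le_trans (ler_wpM2r l1 hcnt) _.
apply: (@le_trans _ _ ((y%:R + S) * (2 * lnn y.+1))).
  by rewrite ler_wpM2l // addr_ge0.
have : y%:R * lnn y.+1 <= y%:R * (2 * y%:R) by rewrite ler_wpM2l // (le_trans ly).
move: (lnn y.+1) (lnn 4) hth => a b hth h.
have -> : (y%:R + S) * (2 * a) = 2 * (y%:R * a) + 2 * (S * a) by ring.
have -> : (4 + 2 * b) * n%:R = 4 * n%:R + 2 * (n%:R * b) by ring.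
lra.
Qed.

(** Each prime weighs at most [ln n] in [theta]; the term [p0.+1] pays for the primes up to [p0]. *)
Lemma prime_count_lower (P : set nat) (Q : pred nat) p0 n :
  (forall p, prime p -> (p0 < p)%N -> Q p -> P p) ->
  theta R Q n <= lnn n * ((prime_count P n)%:R + p0.+1%:R).
Proof.
move=> QP; rewrite prime_countE natr_sum.
have hp0 : (\sum_(0 <= p < n.+1) (p <= p0)%N <= p0.+1)%N.
  have [np|np] := leqP n p0.
    apply: (@leq_trans (\sum_(0 <= p < n.+1) 1)).
      by apply: leq_sum => p _; case: (p <= p0)%N.
    by rewrite sum_nat_const_nat subn0 muln1.
  rewrite (big_cat_nat (n := p0.+1)) //=; last exact: ltnW.
  rewrite [X in (_ + X)%N]big_nat_cond [X in (_ + X)%N]big1 ?addn0; last first.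
    by move=> p /andP[/andP[pp _] _]; rewrite leqNgt pp.
  apply: (@leq_trans (\sum_(0 <= p < p0.+1) 1)).
    by apply: leq_sum => p _; case: (p <= p0)%N.
  by rewrite sum_nat_const_nat subn0 muln1.
apply: (@le_trans _ _ (lnn n * (\sum_(0 <= p < n.+1)
    ((prime p && `[< P p >])%:R + (p <= p0)%N%:R)))); last first.
  apply: ler_wpM2l; first exact: lnn_ge0.
  by rewrite big_split /= lerD2l -natr_sum ler_nat.
rewrite /theta mulr_sumr [leRHS]big_ltn //.
apply: ler_wpDl; first by rewrite mulr_ge0 ?lnn_ge0.
rewrite [leLHS]big_mkcond [leLHS]big_nat [leRHS]big_nat.
apply: ler_sum => p /andP[pgt0 pn].
have l0 := lnn_ge0 R n.
case: ifPn => [/andP[pp Qp]|_]; last by rewrite mulr_ge0.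
apply: (@le_trans _ _ (lnn n * 1)); first by rewrite mulr1 lnn_le.
apply: ler_wpM2l => //; rewrite pp /= -natrD ler1n.
have [//|pp0] := leqP p p0; first by rewrite addn1.
by rewrite asboolT //; exact: QP.
Qed.

Lemma lower_prime_density_gt0 (P : set nat) (Q : pred nat) p0 (c : R) n1 :
  (forall p, prime p -> (p0 < p)%N -> Q p -> P p) -> 0 < c ->
  (forall n, (n1 <= n)%N -> c * n%:R <= theta R Q n) ->
  0 < lower_prime_density R P.
Proof.
move=> QP c0 hth.
pose C' : R := 4 + 2 * lnn 4.
have C'0 : 0 < C' by have := lnn_ge0 R 4; rewrite /C'; lra.
(* Half of [c] survives the loss of the primes up to [p0]; [C'] is the constant of
   [prime_count_upper]. *)
pose delta : R := c / (2 * C').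
have d0 : 0 < delta by rewrite divr_gt0 // mulr_gt0.
pose u n : R := (prime_count P n)%:R / (prime_count setT n)%:R.
have cntle n : (prime_count P n <= prime_count setT n)%N.
  rewrite !prime_countE; apply: leq_sum => p _.
  rewrite (asboolT (I : [set: nat] p)) andbT.
  by case: (prime p); case: asbool.
have u01 n : 0 <= u n <= 1.
  rewrite /u divr_ge0 //=; have := cntle n; case: (prime_count setT n) => [|k] h.
    by rewrite invr0 mulr0.
  by rewrite ler_pdivrMr ?ltr0n // mul1r ler_nat.
(* Chosen so that [p0.+1 * ln n <= (c / 2) n] for [n >= n2]. *)
pose e : R := c / (4 * p0.+1%:R).
have e0 : 0 < e by rewrite divr_gt0 // mulr_gt0.
have [ce ce0 hce] := lnn_le_eps e0.
pose n2 := maxn (maxn n1 2) (Num.truncn (4 * p0.+1%:R * ce / c)).+1.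
have hu n : (n2 <= n)%N -> delta <= u n.
  rewrite !geq_max => /andP[/andP[n1n n2n] n3n].
  have n0 : (0 < n)%N by lia.
  have n0R : 0 < n%:R :> R by rewrite ltr0n.
  have ln0 : 0 < lnn n by apply: ln_gt0; rewrite ltr1n.
  have h1 := hth n n1n; have h2 := prime_count_lower n QP.
  have h3 := prime_count_upper n2n.
  have h4 : p0.+1%:R * lnn n <= c / 2 * n%:R.
    have := ler_wpM2l (ler0n R p0.+1) (hce n n0).
    have : 4 * p0.+1%:R * ce / c <= n%:R.
      by apply: le_trans (ltW (truncnS_gt _)) _; rewrite ler_nat.
    rewrite ler_pdivrMr // => h5.
    have -> : p0.+1%:R * (e * n%:R + ce) = c / 4 * n%:R + p0.+1%:R * ce.
      have := ltr0Sn R p0; rewrite /e; move: (p0.+1%:R : R) => x x0.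
      by field; rewrite gt_eqF.
    by move=> h6; apply: le_trans h6 _; move: (n%:R : R) h5 => ? ?; lra.
  have h7 : c / 2 * n%:R <= lnn n * (prime_count P n)%:R.
    by move: h2; rewrite mulrDr [lnn n * p0.+1%:R]mulrC; lra.
  have pi0 : 0 < (prime_count setT n)%:R :> R.
    rewrite ltr0n prime_countE (bigD1_seq 2%N) ?iota_uniq //=.
      by rewrite asboolT.
    by rewrite mem_index_iota.
  rewrite /u ler_pdivlMr // -(ler_pM2l ln0) /delta.
  apply: le_trans h7.
  have -> : lnn n * (c / (2 * C') * (prime_count setT n)%:R) =
    c / (2 * C') * ((prime_count setT n)%:R * lnn n) by ring.
  apply: (@le_trans _ _ (c / (2 * C') * (C' * n%:R))).
    by rewrite ler_wpM2l // divr_ge0 ?mulr_ge0 // ltW.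
  by rewrite le_eqVlt; apply/orP; left; apply/eqP; field; rewrite gt_eqF.
have u_lb : has_lbound (range u) by exists 0 => _ [n _ <-]; case/andP: (u01 n).
have u_ub : has_ubound (range u) by exists 1 => _ [n _ <-]; case/andP: (u01 n).
(* For bounded [u] the lower limit is the supremum of [infs u], so a bound on the single value
   [infs u n2] suffices. *)
have -> : lower_prime_density R P = sup (range (infs u)).
  apply/cvg_lim => //; exact: cvg_infs_sup.
have dn2 : delta <= infs u n2.
  apply: lb_le_inf; first by exists (u n2); exists n2 => /=.
  by move=> _ [n /= hn <-]; exact: hu.
apply: (lt_le_trans d0); apply: (le_trans dn2).
apply: ub_le_sup; last by exists n2.
exists 1 => _ [n _ <-]; apply: (@le_trans _ _ (u n)); last by case/andP: (u01 n).
by apply: ge_inf; [exact: has_lbound_sdrop | exists n => /=].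
Qed.

End PrimeDensity.

(** * The quadratic character attached to M *)

(** Divide [X^n - 1] by [X - 1] and evaluate at 1. *)
Lemma prod_one_sub_unity_root (F : fieldType) n (z : F) :
  n.-primitive_root z -> \prod_(1 <= k < n) (1 - z ^+ k) = n%:R.
Proof.
move=> prz; have n0 := prim_order_gt0 prz.
have := factor_Xn_sub_1 prz; rewrite subrX1 big_ltn // expr0.
have X1 : 'X - 1%:P != 0 :> {poly F} by rewrite polyXsubC_eq0.
move/(mulfI X1)/(congr1 (horner^~ 1)).
rewrite horner_prod horner_sum => e.
transitivity (\prod_(1 <= i < n) ('X - (z ^+ i)%:P).[1]).
  by apply: eq_bigr => i _; rewrite hornerXsubC.
rewrite e (eq_bigr (fun => 1)); last by move=> i _; rewrite hornerXn expr1n.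
by rewrite sumr_const card_ord.
Qed.

Lemma prod_reflect (F : fieldType) (g : nat -> F) c h :
  \prod_(1 <= k < h.+1) g k * \prod_(c <= k < c + h) g k =
  \prod_(1 <= k < h.+1) (g k * g (c + h - k)%N).
Proof.
rewrite big_split /=; congr (_ * _).
rewrite -{1}[c]add0n big_addn addKn big_mkord.
rewrite (reindex_inj rev_ord_inj) /= big_add1 big_mkord.
by apply: eq_bigr => -[i /= hi] _; congr (g _); lia.
Qed.

(** * Square roots of integers in the cyclotomic ring of level [8 n] *)

Section CyclotomicSqrt.
Variables (n : nat) (z : algC).
Hypothesis prz : (8 * n)%N.-primitive_root z.

(** The ring [Z[z]]; integer coefficients are what the Frobenius congruence requires. *)
Definition inZz (x : algC) := exists f : {poly int}, x = (map_poly intr f).[z].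

Lemma inZzM x y : inZz x -> inZz y -> inZz (x * y).
Proof. by move=> [f ->] [g ->]; exists (f * g); rewrite rmorphM hornerM. Qed.

Lemma inZzD x y : inZz x -> inZz y -> inZz (x + y).
Proof. by move=> [f ->] [g ->]; exists (f + g); rewrite rmorphD hornerD. Qed.

Lemma inZzB x y : inZz x -> inZz y -> inZz (x - y).
Proof. by move=> [f ->] [g ->]; exists (f - g); rewrite rmorphB hornerD hornerN. Qed.

Lemma inZzX k : inZz (z ^+ k).
Proof. by exists 'X^k; rewrite map_polyXn hornerXn. Qed.

Lemma inZz1 : inZz 1. Proof. exact: (inZzX 0). Qed.

Lemma unity_index_gt0 : (0 < n)%N.
Proof. by have := prim_order_gt0 prz; rewrite muln_gt0. Qed.

Lemma zeta_half : z ^+ (4 * n) = -1.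
Proof.
have h : (z ^+ (4 * n)) ^+ 2 = 1.
  by rewrite -exprM (_ : 4 * n * 2 = 8 * n)%N ?prim_expr_order //; lia.
have : (z ^+ (4 * n) - 1) * (z ^+ (4 * n) + 1) = 0.
  by rewrite -subr_sqr h expr1n subrr.
move/eqP; rewrite mulf_eq0 subr_eq0 addr_eq0 => /orP[|/eqP//].
rewrite -(prim_order_dvd prz) => /dvdn_leq.
by have := unity_index_gt0; rewrite muln_gt0 /=; lia.
Qed.

Lemma inZz_sqrtN1 : exists2 y, inZz y & y ^+ 2 = -1.
Proof.
exists (z ^+ (2 * n)); first exact: inZzX.
by rewrite -exprM (_ : 2 * n * 2 = 4 * n)%N ?zeta_half //; lia.
Qed.

Lemma inZz_sqrt2 : exists2 y, inZz y & y ^+ 2 = 2%:R.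
Proof.
(* A primitive 8th root of unity plus its inverse. *)
exists (z ^+ n + z ^+ (7 * n)); first by apply: inZzD; exact: inZzX.
have e7 : z ^+ (7 * n) = (z ^+ n) ^+ 7 by rewrite -exprM mulnC.
have e4 : (z ^+ n) ^+ 4 = -1 by rewrite -exprM mulnC zeta_half.
rewrite e7; set s := z ^+ n in e4 *.
have -> : (s + s ^+ 7) ^+ 2 = s ^+ 2 + 2%:R * (s ^+ 4) ^+ 2 + (s ^+ 4) ^+ 3 * s ^+ 2.
  by ring.
by rewrite e4; ring.
Qed.

Lemma inZz_prod (s : seq nat) g :
  (forall k, inZz (g k)) -> inZz (\prod_(k <- s) g k).
Proof. by move=> hg; apply: big_ind; [exact: inZz1 | exact: inZzM |]. Qed.

(** Factor [n] as the product of [1 - w ^ k], [0 < k < n], with [w = z ^ 8]. The factors at [k] and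
    [n - k] multiply to minus the square of [w ^ (k/2) - w ^ (-k/2)], where [w ^ (1/2)] is [z ^ 4].
    For even [n] the middle factor 2 is left over. *)
Lemma inZz_sqrt_nat : exists2 y, inZz y & y ^+ 2 = n%:R.
Proof.
have n0 := unity_index_gt0.
have prw : n.-primitive_root (z ^+ 8).
  rewrite (_ : n = 8 * n %/ gcdn 8 (8 * n))%N; last by rewrite gcdnMr mulKn.
  exact: exp_prim_root.
have [i iZ i2] := inZz_sqrtN1; have [s sZ s2] := inZz_sqrt2.
(* [z ^ (4 * (2 * n - k))] is the inverse of [z ^ (4 * k)], and [i] absorbs the sign. *)
pose t k := i * (z ^+ (4 * k) - z ^+ (4 * (2 * n - k))).
have tZ k : inZz (t k) by apply: inZzM => //; apply: inZzB; exact: inZzX.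
have t2 k : (k <= n)%N -> t k ^+ 2 = (1 - (z ^+ 8) ^+ k) * (1 - (z ^+ 8) ^+ (n - k)).
  move=> kn; rewrite /t exprMn i2 -!exprM.
  have e1 : z ^+ (8 * k) = (z ^+ (4 * k)) ^+ 2 by rewrite -exprM; congr (_ ^+ _); lia.
  have e2 : z ^+ (8 * (n - k)) = (z ^+ (4 * (2 * n - k))) ^+ 2.
    rewrite -exprM (_ : 4 * (2 * n - k) * 2 = 8 * (n - k) + 8 * n)%N; last by lia.
    by rewrite exprD (prim_expr_order prz) mulr1.
  have e3 : z ^+ (4 * k) * z ^+ (4 * (2 * n - k)) = 1.
    by rewrite -exprD -mulnDr subnKC ?mulnA ?(prim_expr_order prz) //; lia.
  rewrite e1 e2; move: e3; set x := z ^+ (4 * k); set y := z ^+ _ => e3.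
  have -> : (1 - x ^+ 2) * (1 - y ^+ 2) = 1 - x ^+ 2 - y ^+ 2 + (x * y) ^+ 2 by ring.
  have -> : (x - y) ^+ 2 = x ^+ 2 + y ^+ 2 - 2%:R * (x * y) by ring.
  by rewrite e3; ring.
have := prod_one_sub_unity_root prw; set g := fun k => 1 - (z ^+ 8) ^+ k.
rewrite -[\prod_(_ <= _ < _) _]/(\prod_(1 <= k < n) g k) => e.
have half h : (2 * h < n)%N -> \prod_(1 <= k < h.+1) (g k * g (n - k)%N) =
    (\prod_(1 <= k < h.+1) t k) ^+ 2.
  move=> hn; rewrite -prodrXl [LHS]big_nat [RHS]big_nat; apply: eq_bigr => k hk.
  by rewrite t2 //; lia.
have [h [en|en]] : exists h, n = (2 * h).+1 \/ n = (2 * h).+2.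
  by exists n.-1./2; have := odd_double_half n.-1; case: odd => /= ?; [right | left]; lia.
  exists (\prod_(1 <= k < h.+1) t k); first exact: inZz_prod.
  have en2 : n = (h.+1 + h)%N by lia.
  rewrite -half; last by lia.
  rewrite -e [RHS](big_cat_nat (n := h.+1)) //=; last by lia.
  by rewrite [in RHS]en2 prod_reflect -en2.
exists (s * \prod_(1 <= k < h.+1) t k); first by apply: inZzM => //; exact: inZz_prod.
have en2 : n = (h.+2 + h)%N by lia.
rewrite exprMn s2 -half; last by lia.
rewrite -e [RHS](big_cat_nat (n := h.+1)) //=; last by lia.
rewrite [X in _ = _ * X]big_ltn; last by lia.
rewrite [RHS]mulrCA [in X in _ = _ * (_ * X)]en2 prod_reflect -en2.
congr (_ * _); rewrite /g -exprM (_ : 8 * h.+1 = 4 * n)%N; last by lia.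
by rewrite zeta_half opprK.
Qed.

Lemma inZz_sqrt_int (M : int) : `|M|%N = n -> exists2 y, inZz y & y ^+ 2 = M%:~R.
Proof.
move=> eM; have [y yZ y2] := inZz_sqrt_nat; have [i iZ i2] := inZz_sqrtN1.
case: (intP M) eM => [|k|k] /= eM.
- by move: unity_index_gt0; rewrite -eM.
- by exists y => //; rewrite y2 -eM.
- exists (i * y); first exact: inZzM.
  by rewrite exprMn i2 y2 -eM mulN1r mulrNz.
Qed.

End CyclotomicSqrt.

(** * Congruences modulo [p] between algebraic integers *)

Lemma Aint_Frobenius_add (p : nat) (a b : algC) : prime p ->
  a \in Aint -> b \in Aint -> (((a + b) ^+ p)%R == (a ^+ p + b ^+ p)%R %[mod p])%A.
Proof.
move=> pp aA bA; rewrite /eqAmod exprDn; case: p pp => // p pp.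
rewrite big_ord_recl big_ord_recr /= subn0 subnn !expr0 mulr1 mul1r bin0 binn.
rewrite !mulr1n; set S := \sum_(_ < _) _.
have -> : a ^+ p.+1 + (S + b ^+ p.+1) - (a ^+ p.+1 + b ^+ p.+1) = S by ring.
apply: rpred_sum => i _.
have /dvdnP[q ->] : (p.+1 %| 'C(p.+1, bump 0 i))%N.
  by apply: prime_dvd_bin => //; rewrite /bump /=; have := ltn_ord i; lia.
rewrite mulrnA -mulr_natr -eqAmod0; apply: eqAmodMl0.
by rewrite rpredMn // rpredM // rpredX.
Qed.

Lemma Aint_horner (f : {poly int}) (z : algC) :
  z \in Aint -> (map_poly intr f).[z] \in Aint.
Proof.
move=> zA; rewrite horner_coef; apply: rpred_sum => i _.
by rewrite coef_map rpredM ?rpredX // Aint_int.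
Qed.

Lemma intr_Fp_eq0 p (c : int) :
  prime p -> ((c%:~R : 'F_p) == 0) = (p%:Z %| c)%Z.
Proof.
move=> pp; rewrite dvdzE /=.
case: (intP c) => [|k|k]; first by rewrite eqxx dvdn0.
- by rewrite -(dvdn_pcharf (pchar_Fp pp)).
- by rewrite mulrNz oppr_eq0 -(dvdn_pcharf (pchar_Fp pp)).
Qed.

Lemma fermat_int p (c : int) : prime p -> (p%:Z %| c ^+ p - c)%Z.
Proof.
move=> pp; rewrite -intr_Fp_eq0 // rmorphB rmorphXn /=.
by rewrite -[X in _ ^+ X](card_Fp pp) expf_card subrr.
Qed.

(** Frobenius is additive modulo [p] and, by Fermat, fixes the integer coefficients; induction along
    Horner's scheme. *)
Lemma Aint_Frobenius_horner (p : nat) (f : {poly int}) (z : algC) :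
  prime p -> z \in Aint ->
  ((map_poly intr f).[z] ^+ p == (map_poly intr f).[z ^+ p] %[mod p])%A.
Proof.
move=> pp zA; elim/poly_ind: f => [|f c IH].
  by rewrite rmorph0 !horner0 expr0n gtn_eqF ?prime_gt0.
rewrite rmorphD rmorphM /= map_polyX map_polyC !hornerE.
have fA := Aint_horner f zA.
have cA : (c%:~R : algC) \in Aint by exact: Aint_int.
apply: eqAmod_trans (Aint_Frobenius_add pp _ cA) _; first exact: rpredM.
apply: eqAmodD; first by rewrite exprMn; apply: eqAmodMr; rewrite ?rpredX.
have /dvdzP[q e] := fermat_int c pp.
rewrite /eqAmod -rmorphXn -rmorphB /= e rmorphM /= -eqAmod0.
by apply: eqAmodMl0; exact: Aint_int.
Qed.

Lemma dvdA_int (p : nat) (c : int) :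
  (0 < p)%N -> (p %| (c%:~R : algC))%A -> (p%:Z %| c)%Z.
Proof.
move=> p0; rewrite unfold_in; have p0C : p%:R != 0 :> algC by rewrite pnatr_eq0 -lt0n.
rewrite (negbTE p0C) => /Cint_rat_Aint h.
have /intrP[q e] : (c%:~R / p%:R : algC) \in Num.int.
  by apply: h; rewrite rpred_div ?rpred_int ?rpred_nat.
apply/dvdzP; exists q; apply/eqP; rewrite -(eqr_int algC) rmorphM /= -e.
by rewrite -mulrA mulVf ?mulr1.
Qed.

Section KroneckerCharacter.
Variable M : int.
Hypothesis M_neq0 : M != 0.

Let N := (8 * `|M|)%N.

(** A square root [x] of [M] lies in [Z[z]], and [chi k] is the sign by which the automorphism
    [z -> z ^ k] acts on it. *)
Lemma quadratic_character_exists :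
  ~ (exists s : int, s ^+ 2 = M) ->
  exists chi : nat -> int,
    [/\ forall m n, chi (m * n)%N = chi m * chi n,
        forall n, chi (n + N)%N = chi n,
        forall n, [\/ chi n = 1, chi n = 0 | chi n = -1],
        forall n, (chi n == 0) = ~~ coprime n N &
        (exists n, chi n = -1) /\
        forall p, prime p -> chi p = -1 ->
          ~ (exists x : int, (x ^+ 2 = M %[mod p%:Z])%Z)].
Proof.
move=> Mns.
have M0 : (0 < `|M|)%N by rewrite absz_gt0.
have N0 : (0 < N)%N by rewrite muln_gt0.
have [z prz] := C_prim_root_exists N0.
have [x [f xE] x2] := inZz_sqrt_int prz (erefl _).
have x0 : x != 0.
  by apply: contra_neq M_neq0 => x0; apply/eqP; rewrite -(intr_eq0 algC) -x2 x0 expr0n.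
pose F y := (map_poly (intr : int -> algC) f).[y].
have autF k : coprime k N -> exists u : {rmorphism algC -> algC},
    forall j, u (F (z ^+ j)) = F (z ^+ (j * k)).
  move=> /Qn_aut_exists[u hu]; exists u => j.
  rewrite /F -horner_map /= -map_poly_comp hu.
    by rewrite -exprM; congr _.[_]; apply: eq_map_poly => a /=; rewrite rmorph_int.
  by rewrite -exprM mulnC exprM (prim_expr_order prz) expr1n.
pose chi k : int := if coprime k N then (if F (z ^+ k) == x then 1 else -1) else 0.
have F1 : F (z ^+ 1) = x by rewrite /F expr1 -xE.
have chiE k : coprime k N -> F (z ^+ k) = (chi k)%:~R * x.
  move=> kN; rewrite /chi kN; have [u hu] := autF k kN.
  have : F (z ^+ k) ^+ 2 = x ^+ 2.
    by rewrite -[k]mul1n -hu F1 -rmorphXn /= x2 rmorph_int.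
  move/eqP; rewrite eqf_sqr; case: eqP => [-> _ |_ /= /eqP->]; first by rewrite mul1r.
  by rewrite mulN1r.
have chi_val n : [\/ chi n = 1, chi n = 0 | chi n = -1].
  rewrite /chi; case: ifP => _; last by constructor 2.
  by case: ifP => _; [constructor 1 | constructor 3].
have chi_eq0 n : (chi n == 0) = ~~ coprime n N.
  by rewrite /chi; case: ifP => // _; case: ifP.
have zA : z \in Aint by apply: (Aint_unity_root N0); rewrite unity_rootE prim_expr_order.
have xA : x \in Aint by rewrite xE; exact: Aint_horner.
exists chi; split=> //.
- move=> m n.
  have [/andP[mN nN]|] := boolP (coprime m N && coprime n N); last first.
    rewrite negb_and /chi coprimeMl.
    case: (coprime m N) => /=; last by rewrite mul0r.
    by case: (coprime n N) => //= _; rewrite mulr0.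
  have mnN : coprime (m * n) N by rewrite coprimeMl mN.
  (* Apply the automorphism [z -> z ^ n] to [F (z ^ m) = chi m * x]. *)
  have [u hu] := autF n nN.
  apply/eqP; rewrite -(eqr_int algC) -(inj_eq (mulIf x0)) -chiE // -hu chiE //.
  by rewrite rmorphM rmorph_int -{1}F1 hu mul1n chiE // mulrA rmorphM.
- move=> n; rewrite /chi exprD (prim_expr_order prz) mulr1.
  by rewrite ![coprime _ N]coprime_sym /coprime gcdnDr.
- split.
    (* If [chi] avoided -1, [F] would equal [x] at every primitive root. Reduced modulo the
       cyclotomic polynomial, [f] has degree below [totient N] and takes the value [x] at
       [totient N] points, so it is constant and [x] is an integer. *)
    apply: contrapT => chiN1; apply: Mns.
    have FE k : coprime k N -> F (z ^+ k) = x.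
      move=> kN; rewrite chiE //; have [->|ck|ck] := chi_val k.
      - by rewrite mul1r.
      - by move: (chi_eq0 k); rewrite ck eqxx kN.
      - by case: chiN1; exists k.
    pose r0 := Pdiv.Ring.rmodp f 'Phi_N.
    have r0E k : coprime k N -> (map_poly (intr : int -> algC) r0).[z ^+ k] = x.
      move=> kN; rewrite -(FE k kN) /F.
      rewrite [in RHS](Pdiv.RingMonic.rdivp_eq (Cyclotomic_monic N) f).
      rewrite rmorphD rmorphM /= hornerD hornerM (Cintr_Cyclotomic prz).
      have /rootP-> : root (cyclotomic z N) (z ^+ k).
        by rewrite (root_cyclotomic prz) prim_root_exp_coprime.
      by rewrite mulr0 add0r.
    pose g := map_poly (intr : int -> algC) r0 - x%:P.
    pose rs := [seq z ^+ k | k <- [seq k <- iota 0 N | coprime N k]].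
    have szrs : size rs = totient N.
      rewrite size_map size_filter totient_count_coprime -sum1_count.
      by rewrite big_mkcond /index_iota subn0; apply: eq_bigr => k _; case: coprime.
    have g0 : g = 0.
      apply/eqP; apply: contraT => gn0.
      have := max_poly_roots gn0 (rs := rs).
      have -> : all (root g) rs.
        apply/allP => y /mapP[k + ->]; rewrite mem_filter => /andP[kN _].
        by rewrite /root /g hornerD hornerN hornerC r0E ?subrr // coprime_sym.
      have -> : uniq rs.
        rewrite map_inj_in_uniq ?filter_uniq ?iota_uniq // => i j.
        rewrite !mem_filter !mem_iota /= !add0n => /andP[_ iN] /andP[_ jN] /eqP.
        by rewrite (eq_prim_root_expr prz) !modn_small // => /eqP.
      move=> /(_ isT isT); rewrite szrs ltnNge => /negP[].
      apply: leq_trans (size_polyD _ _) _; rewrite geq_max size_polyN.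
      rewrite (leq_trans (size_poly _ _)) /=; last first.
        rewrite -ltnS -size_Cyclotomic Pdiv.Ring.ltn_rmodp.
        exact: monic_neq0 (Cyclotomic_monic N).
      by apply: leq_trans (size_polyC_leq1 _) _; rewrite totient_gt0.
    have xE0 : x = (r0`_0)%:~R.
      have := congr1 (fun q : {poly algC} => q`_0) g0.
      by rewrite /g coefB coef_map coefC coef0 /= => /eqP; rewrite subr_eq0 => /eqP.
    exists r0`_0; apply/eqP.
    by rewrite -(eqr_int algC) rmorphXn /= -xE0 x2.
  move=> p pp chip [s sM].
  have pN : coprime p N.
    by rewrite -[coprime p N]negbK -chi_eq0 chip oppr_eq0 oner_eq0.
  have p2M : ~~ (p %| 2 * `|M|)%N.
    rewrite -prime_coprime //; move: pN; rewrite /N !coprimeMr => /andP[p8 ->].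
    by rewrite andbT -(@coprime_pexpr 3).
  have podd : odd p.
    by have /even_prime[p2|//] := pp; move: p2M; rewrite p2 dvdn_mulr.
  have hF := Aint_Frobenius_horner f pp zA.
  have xp : x ^+ p = x * (M ^+ p./2)%:~R.
    by rewrite -[in LHS](odd_double_half p) podd exprS -mul2n exprM x2 rmorphXn.
  (* Frobenius gives [x ^ p = F (z ^ p) = - x] modulo [p], while [x ^ p = x * M ^ p./2]; multiplying
     by [x] yields a congruence between integers. *)
  have hdvd : (p%:Z %| M * (M ^+ p./2 + 1))%Z.
    apply: dvdA_int; first exact: prime_gt0.
    have -> : (M * (M ^+ p./2 + 1))%:~R = x * (x ^+ p - F (z ^+ p)) :> algC.
      by rewrite chiE // chip xp rmorphM rmorphD /= -x2; ring.
    by have := eqAmodMl xA hF; rewrite /eqAmod -mulrBr -xE.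
  move: hdvd; rewrite -intr_Fp_eq0 // rmorphM rmorphD rmorphXn /= mulf_eq0.
  have pM : (M%:~R : 'F_p) != 0.
    rewrite intr_Fp_eq0 // dvdzE /=; apply: contra p2M => /= ?; exact: dvdn_mull.
  rewrite (negbTE pM) /=.
  have eM : (M%:~R : 'F_p) = s%:~R ^+ 2.
    apply/eqP; rewrite -rmorphXn /= -subr_eq0 -rmorphB /= intr_Fp_eq0 //.
    by rewrite -eqz_mod_dvd sM.
  have s0 : (s%:~R : 'F_p) != 0 by apply: contraNneq pM => s0; rewrite eM s0 expr0n.
  (* Fermat for [s]: the factor [M ^ p./2 + 1] becomes 2, which is nonzero modulo the odd [p]. *)
  have -> : (M%:~R : 'F_p) ^+ p./2 = 1.
    apply: (mulIf s0); rewrite mul1r eM -exprM mul2n -exprSr.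
    have -> : p./2.*2.+1 = p by rewrite -[RHS]odd_double_half podd.
    by rewrite -[X in _ ^+ X](card_Fp pp) expf_card.
  rewrite -[1 + 1]/(2%:R) -(dvdn_pcharf (pchar_Fp pp)) => p2.
  by move: p2M; rewrite dvdn_mulr.
Qed.

End KroneckerCharacter.

(** * Denominators of the coefficients *)

Section Denominators.
Variable R : realType.
Implicit Types (z : R[i]) (p N : nat).

(** A monic integer equation for [n / p] transfers through the rationals from [R[i]] to [algC],
    where rational algebraic integers are integers. *)
Lemma algebraic_integer_nat_div p n : prime p ->
  algebraic_integer (n%:R / p%:R : R[i]) -> (p %| n)%N.
Proof.
move=> pp [P monP rootP].
pose x : rat := n%:R / p%:R.
have ratx (F : numFieldType) : ratr x = n%:R / p%:R :> F.
  by rewrite /x fmorph_div /= !ratr_nat.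
have mapP (F : numFieldType) :
    map_poly (intr : int -> F) P = map_poly ratr (map_poly (intr : int -> rat) P).
  by rewrite -map_poly_comp; apply: eq_map_poly => a /=; rewrite ratr_int.
have rootx : root (map_poly (intr : int -> rat) P) x.
  have := fmorph_root (@ratr R[i]) (map_poly (intr : int -> rat) P) x.
  by rewrite /= -mapP ratx => <-.
have : (p %| (n%:Z%:~R : algC))%A.
  rewrite unfold_in; have p0C : p%:R != 0 :> algC by rewrite pnatr_eq0 -lt0n prime_gt0.
  rewrite (negbTE p0C).
  apply: (@root_monic_Aint (map_poly intr P)).
  - have := fmorph_root (@ratr algC) (map_poly (intr : int -> rat) P) x.
    by rewrite /= -mapP ratx rootx.
  - exact: monic_map.
  - by apply/polyOverP => i; rewrite coef_map intr_int.
by move/(dvdA_int (prime_gt0 pp)); rewrite dvdzE.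
Qed.

(** The multipliers making [z] integral are stable under remainders, so the least positive one
    divides all others. *)
Lemma denominator_exists z N0 : (0 < N0)%N -> algebraic_integer (N0%:R * z) ->
  exists2 N, is_denominator z N &
    forall N', algebraic_integer (N'%:R * z) -> (N %| N')%N.
Proof.
move=> N00 hN0.
have ex : exists N, (0 < N)%N && `[< algebraic_integer (N%:R * z) >].
  by exists N0; rewrite N00 asboolT.
case: (ex_minnP ex) => N /andP[Ngt0 /asboolP hN] Nmin.
have hmin N' : (0 < N')%N -> algebraic_integer (N'%:R * z) -> (N <= N')%N.
  by move=> N'0 hN'; apply: Nmin; rewrite N'0 asboolT.
exists N => // N' hN'.
have : algebraic_integer ((N' %% N)%:R * z).
  have -> : (N' %% N)%:R * z = N'%:R * z - (N' %/ N)%:R * (N%:R * z).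
    by rewrite [in N'%:R](divn_eq N' N) natrD natrM; ring.
  apply: integral_sub => //; apply: integral_mul => //; exact: integral_nat.
rewrite /dvdn; have [//|m0] := posnP (N' %% N).
by move/(hmin _ m0); rewrite leqNgt ltn_pmod.
Qed.

(** Algebraic integers localized at [p]: avoiding the least multiplier makes closure under ring
    operations immediate. *)
Definition p_local p z :=
  exists2 N, ~~ (p %| N)%N & algebraic_integer (N%:R * z).

Lemma p_local_p_integral p z : p_local p z -> p_integral p z.
Proof.
move=> [N0 pN0 hN0].
have N00 : (0 < N0)%N by case: N0 pN0 {hN0} => //; rewrite dvdn0.
have [N hN Nmin] := denominator_exists N00 hN0.
exists N => //; apply: contra pN0 => pN; exact: dvdn_trans pN (Nmin _ hN0).
Qed.

Lemma divides_denominatorP p z N0 : (0 < N0)%N -> p_local p (N0%:R * z) ->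
  ~ p_local p z -> divides_denominator p z.
Proof.
move=> N00 [N1 pN1 hN1] hz.
have N10 : (0 < N1)%N by case: N1 pN1 {hN1} => //; rewrite dvdn0.
have N0' : (0 < N1 * N0)%N by rewrite muln_gt0 N10.
have [|N hN _] := denominator_exists (z := z) N0'; first by rewrite natrM -mulrA.
exists N => //; apply: contraPT hz => pN hz; apply: hz; exists N => //.
by case: hN.
Qed.

(** * Ring operations and power series over the localization at [p] *)

Section Localization.
Variable p : nat.
Hypothesis pp : prime p.

Local Notation O := (p_local p).

Lemma p_local_alg z : algebraic_integer z -> O z.
Proof.
by move=> hz; exists 1%N; rewrite ?mul1r // dvdn1; case: p pp => [|[]].
Qed.

Lemma p_local_int (n : int) : O n%:~R.
Proof. by apply: p_local_alg; exact: integral_id. Qed.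

Lemma p_local_nat (n : nat) : O n%:R.
Proof. exact: (p_local_int n). Qed.

Lemma p_localD x y : O x -> O y -> O (x + y).
Proof.
move=> [N pN hN] [N' pN' hN']; exists (N * N')%N.
  by rewrite Euclid_dvdM // negb_or pN.
have -> : (N * N')%:R * (x + y) = N'%:R * (N%:R * x) + N%:R * (N'%:R * y).
  by rewrite natrM; ring.
by apply: integral_add; apply: integral_mul => //; exact: integral_nat.
Qed.

Lemma p_localM x y : O x -> O y -> O (x * y).
Proof.
move=> [N pN hN] [N' pN' hN']; exists (N * N')%N.
  by rewrite Euclid_dvdM // negb_or pN.
by rewrite natrM mulrACA; exact: integral_mul.
Qed.

Lemma p_localN x : O x -> O (- x).
Proof.
by move=> hx; rewrite -mulN1r; apply: p_localM => //; exact: (p_local_int (-1)).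
Qed.

Lemma p_localB x y : O x -> O y -> O (x - y).
Proof. by move=> hx /p_localN; exact: p_localD. Qed.

Lemma p_localX x n : O x -> O (x ^+ n).
Proof.
move=> hx; elim: n => [|n IH]; first exact: (p_local_nat 1).
by rewrite exprS; exact: p_localM.
Qed.

Lemma p_local_sum n (F : 'I_n -> R[i]) : (forall i, O (F i)) -> O (\sum_i F i).
Proof.
by move=> hF; apply: big_ind => //; [exact: (p_local_nat 0) | exact: p_localD].
Qed.

Lemma p_local_prod n (F : 'I_n -> R[i]) : (forall i, O (F i)) -> O (\prod_i F i).
Proof.
by move=> hF; apply: big_ind => //; [exact: (p_local_nat 1) | exact: p_localM].
Qed.

Lemma p_local_natV n : ~~ (p %| n)%N -> O (n%:R^-1).
Proof.
move=> pn; exists n => //; rewrite divff; first exact: integral1.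
by rewrite pnatr_eq0; apply: contraNneq pn => ->.
Qed.

Lemma p_local_intV (n : int) : ~~ (p%:Z %| n)%Z -> O (n%:~R^-1).
Proof.
rewrite dvdzE /=; case: (intP n) => [|k|k] /= pk.
- by rewrite dvdn0 in pk.
- exact: p_local_natV.
- by rewrite mulrNz invrN; apply: p_localN; exact: p_local_natV.
Qed.

Lemma p_local_rat (q : rat) : ~~ (p%:Z %| denq q)%Z -> O (ratr q).
Proof.
by move=> pq; apply: p_localM; [exact: p_local_int | exact: p_local_intV].
Qed.

Lemma p_local_factV n : (n < p)%N -> O ((n`!)%:R^-1).
Proof.
move=> np; apply: p_local_natV; elim: n np => [|n IH] np.
  by rewrite fact0 dvdn1; case: p pp => [|[]].
rewrite factS Euclid_dvdM // negb_or IH 1?ltnW // andbT.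
by apply/negP => /dvdn_leq -/(_ isT); rewrite leqNgt np.
Qed.

(** If [N / c] is integral and [c = d p], then so is [N / p = d * (N / c)], hence [p] divides
    [N]. *)
Lemma not_p_local_intV (c : int) : c != 0 -> (p%:Z %| c)%Z -> ~ O (c%:~R^-1).
Proof.
move=> c0 /dvdzP[d e] [N pN hN].
have p0 : p%:R != 0 :> R[i] by rewrite pnatr_eq0 -lt0n prime_gt0.
move/negP: pN; apply; apply: algebraic_integer_nat_div => //.
have -> : N%:R / p%:R = d%:~R * (N%:R / c%:~R) :> R[i].
  move: c0; rewrite e mulf_eq0 negb_or => /andP[d0 _].
  have d0C : d%:~R != 0 :> R[i] by rewrite intr_eq0.
  rewrite rmorphM /= -pmulrn; field; rewrite ?p0 ?d0C //.
by apply: integral_mul => //; exact: integral_id.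
Qed.

Lemma p_local_gbinom s j : (j < p)%N -> O s -> O (gbinom s j).
Proof.
move=> jp hs; apply: p_localM; last exact: p_local_factV.
by apply: p_local_prod => i; apply: p_localB => //; exact: p_local_nat.
Qed.

Lemma p_local_fps_mul (f g : nat -> R[i]) n :
  (forall i, (i <= n)%N -> O (f i)) -> (forall i, (i <= n)%N -> O (g i)) ->
  O (fps_mul f g n).
Proof.
move=> hf hg; apply: p_local_sum => i; apply: p_localM; first by apply: hf; rewrite -ltnS.
by apply: hg; rewrite leq_subr.
Qed.

Lemma p_local_fps_exp (f : nat -> R[i]) j n :
  (forall i, O (f i)) -> O (fps_exp f j n).
Proof.
move=> hf; elim: j n => [|j IH] n; first exact: p_local_nat.
by rewrite /fps_exp iterS; apply: p_local_fps_mul => i _; [exact: hf | exact: IH].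
Qed.

Lemma p_local_fps_comp (g f : nat -> R[i]) n :
  (forall j, (j <= n)%N -> O (g j)) -> (forall i, O (f i)) -> O (fps_comp g f n).
Proof.
move=> hg hf; apply: p_local_sum => j; apply: p_localM; last exact: p_local_fps_exp.
by apply: hg; rewrite -ltnS.
Qed.

Lemma p_local_fps_powc (f : nat -> R[i]) s n : (n < p)%N ->
  O s -> (forall i, O (f i)) -> O (fps_powc f s n).
Proof.
move=> np hs hf; apply: p_local_fps_comp => [j jn|i].
  by apply: p_local_gbinom => //; exact: leq_ltn_trans np.
by apply: p_localB; [exact: hf | exact: p_local_nat].
Qed.

Lemma gbinomN1 (K : numFieldType) j : gbinom (-1 : K) j = (-1) ^+ j.
Proof.
have f0 : (j`!)%:R != 0 :> K by rewrite pnatr_eq0 -lt0n fact_gt0.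
apply: (mulIf f0); rewrite /gbinom divfK //; elim: j {f0} => [|j IH].
  by rewrite big_ord0 fact0 mulr1.
by rewrite big_ord_recr /= IH factS natrM exprS -natr1; ring.
Qed.

Hypothesis p_gt3 : (3 < p)%N.

Lemma p_local_3V : O (3^-1).
Proof. by apply: (@p_local_natV 3); apply/negP => /dvdn_leq -/(_ isT); lia. Qed.

Lemma p_ndvd2 : ~~ (p %| 2)%N.
Proof. by apply/negP => /dvdn_leq -/(_ isT); lia. Qed.

Lemma p_ndvd64 : ~~ (p %| 64)%N.
Proof. by rewrite -[64%N]/(2 ^ 6)%N Euclid_dvdX // negb_and p_ndvd2. Qed.

(** Eisenstein coefficients are integers and binomials of exponent -1 are signs, so only powers of 3
    could occur in denominators, at every index. *)
Lemma p_local_Jinv n : O (Jinv R[i] n).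
Proof.
apply: p_localM; last exact: p_local_3V.
have hG i : O (G2_fps R[i] i) by apply: p_local_fps_mul => *; exact: p_local_int.
apply: p_local_fps_mul => i _.
  by apply: p_localB; [exact: p_local_int | exact: hG].
apply: p_local_fps_comp => [j _|k]; last first.
  by apply: p_localB; [exact: hG | exact: p_local_nat].
by rewrite gbinomN1; exact: p_localX (p_local_int (-1)).
Qed.

Lemma p_local_Kinv n : O (Kinv R[i] n).
Proof.
apply: p_localM; [exact: p_local_Jinv | exact: (@p_local_natV 64 p_ndvd64)].
Qed.

End Localization.

Lemma fps_powc0 (K : fieldType) (f : nat -> K) s : fps_powc f s 0 = 1.
Proof.
rewrite /fps_powc /fps_comp big_ord1 /fps_exp /= mulr1 /gbinom big_ord0 fact0.
by rewrite divr1.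
Qed.

(** Since [f] is divisible by [q], only its leading terms meet in degree [n] of the [n]-th power. *)
Lemma fps_exp_diag (K : fieldType) (f : nat -> K) n m : f 0%N = 0 -> (m <= n)%N ->
  fps_exp f n m = if m == n then f 1%N ^+ n else 0.
Proof.
move=> f0; elim: n m => [|n IH] m mn.
  by move: mn; rewrite leqn0 => /eqP->; rewrite /fps_exp /= expr0.
rewrite /fps_exp iterS -/(fps_exp f n) /fps_mul.
case: m mn => [|m] mn; first by rewrite big_ord1 f0 mul0r.
rewrite big_ord_recl f0 mul0r add0r big_ord_recl /= subSS subn0.
rewrite IH; last by rewrite -ltnS.
rewrite big1 ?addr0.
  by rewrite eqSS; case: ifP => _; rewrite ?mulr0 // exprS.
move=> i _; rewrite /bump /= !add1n subSS IH; last by rewrite (leq_trans (leq_subr _ _)).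
rewrite ifF ?mulr0 //; apply/negbTE; rewrite neq_ltn; apply/orP; left.
have := ltn_ord i; lia.
Qed.

Lemma Jinv0 (K : numFieldType) : Jinv K 0 = 0.
Proof.
rewrite /Jinv /fps_mul big_ord1 /= /G2_fps /fps_mul big_ord1 /=.
have -> : G_coef 0 = 1 by [].
by rewrite mulr1 subrr !mul0r.
Qed.

(** From [E_4 - G^2 = (240 - 48) q + ...] and the division by 3. *)
Lemma Jinv1 (K : numFieldType) : Jinv K 1 = 64.
Proof.
have s1 k : sigma k 1 = 1%N by rewrite /sigma /divisors /= big_seq1 exp1n.
have g0 : G_coef 0 = 1 by [].
have g1 : G_coef 1 = 24 by rewrite /G_coef /= s1.
have e1 : E4_coef 1 = 240 by rewrite /E4_coef s1.
have G20 : G2_fps K 0 = 1 by rewrite /G2_fps /fps_mul big_ord1 g0 mulr1.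
have G21 : G2_fps K 1 = 48.
  by rewrite /G2_fps /fps_mul big_ord_recl big_ord1 /= g0 g1; ring.
rewrite /Jinv /fps_mul big_ord_recl big_ord1 /= G20 subrr mul0r add0r.
rewrite (_ : bump 0 0 = 1%N) // subnn fps_powc0 mulr1 G21.
rewrite -[(240 * _)%:~R]/((E4_coef 1)%:~R) e1.
by field.
Qed.

Lemma p_local_pochhammer p x n : prime p -> p_local p x -> p_local p (pochhammer x n).
Proof.
move=> pp hx; apply: p_local_prod => // i.
by apply: p_localD => //; exact: p_local_nat.
Qed.

Lemma pochhammer_unit p x n : prime p ->
  (forall i : 'I_n, x + i%:R != 0 /\ p_local p ((x + i%:R)^-1)) ->
  pochhammer x n != 0 /\ p_local p ((pochhammer x n)^-1).
Proof.
move=> pp hx; split; first by apply/prodf_neq0 => i _; case: (hx i).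
by rewrite -prodfV; apply: p_local_prod => // i; case: (hx i).
Qed.

(* Only the last summand of the Cauchy product involves g n. *)
Lemma p_local_fps_mul_sub p (f g : nat -> R[i]) n : prime p ->
  (forall i, (i <= n)%N -> p_local p (f i)) ->
  (forall i, (i < n)%N -> p_local p (g i)) ->
  p_local p (fps_mul f g n - f 0%N * g n).
Proof.
move=> pp hf hg; rewrite /fps_mul big_ord_recl subn0 addrAC subrr add0r.
apply: p_local_sum => // i; have := ltn_ord i => hi.
apply: p_localM => //; first by apply: hf.
by apply: hg; rewrite /= /bump /=; lia.
Qed.

(** In degree [n], [g n] occurs only with the leading coefficient of [f ^ n]; all other terms use
    [g j] with [j < n]. *)
Lemma p_local_fps_comp_sub p (g f : nat -> R[i]) n : prime p -> f 0%N = 0 ->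
  (forall j, (j < n)%N -> p_local p (g j)) -> (forall i, p_local p (f i)) ->
  p_local p (fps_comp g f n - g n * f 1%N ^+ n).
Proof.
move=> pp f0 hg hf; rewrite /fps_comp big_ord_recr /= fps_exp_diag // eqxx addrK.
apply: p_local_sum => // j; apply: p_localM => //; last exact: p_local_fps_exp.
by apply: hg; rewrite /= ltn_ord.
Qed.

(** * The first coefficient that is not [p]-integral *)

Section HypergeometricCoefficient.
Variables (p K : nat) (A B r : R[i]) (u v : int).
Hypotheses (pp : prime p) (p_gt3 : (3 < p)%N).
Hypotheses (v_gt1 : 1 < v) (cop_uv : coprimez u v) (pv : ~~ (p%:Z %| v)%Z).
Hypothesis huv : A - B = u%:~R / v%:~R.
Hypotheses (hr : p_local p r) (hBr : p_local p (B - r)).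
Hypothesis hB : forall i : nat, B + i%:R != 0 /\ p_local p ((B + i%:R)^-1).
Hypothesis hB2 : forall i : nat,
  1 / 2 + B + i%:R != 0 /\ p_local p ((1 / 2 + B + i%:R)^-1).
Hypotheses (K_gt0 : (0 < K)%N) (K_ltp : (K < p)%N) (pK : (p%:Z %| K%:Z * v - u)%Z).

Local Notation O := (p_local p).
Local Notation z := (1 + B - A).
Local Notation hyp := (hyp2F1 B (1 / 2 + B) z).

Let v0 : v%:~R != 0 :> R[i].
Proof. by rewrite intr_eq0; lia. Qed.

(** Turns [p]-divisibility of the Pochhammer factors into divisibility of integers. *)
Let zE (i : nat) : z + i%:R = (i.+1%:Z * v - u)%:~R / v%:~R.
Proof.
have -> : z + i%:R = i.+1%:R - (A - B) by rewrite -natr1; ring.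
by rewrite huv rmorphB rmorphM /= -pmulrn; field.
Qed.

Let c_neq0 (i : nat) : i.+1%:Z * v - u != 0.
Proof.
apply: contraL cop_uv; rewrite subr_eq0 => /eqP <-.
rewrite /coprimez gcdzC gcdzMl /=; lia.
Qed.

(** Otherwise, subtracting from [K v - u], [p] would divide [(K - i - 1) v], with
    [0 < K - i - 1 < p]. *)
Let p_ndvd_c (i : nat) : (i.+1 < K)%N -> ~~ (p%:Z %| i.+1%:Z * v - u)%Z.
Proof.
move=> iK; apply/negP => pi.
have : (p%:Z %| (K - i.+1)%N%:Z * v)%Z.
  have -> : (K - i.+1)%N%:Z * v = (K%:Z * v - u) - (i.+1%:Z * v - u).
    by rewrite -subzn; [ring | exact: ltnW].
  by rewrite rpredB.
rewrite dvdzE abszM /= Euclid_dvdM //; move: pv; rewrite dvdzE /= => /negbTE->.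
by rewrite orbF => /dvdn_leq; lia.
Qed.

Let z_unit n : (n < K)%N ->
  pochhammer z n != 0 /\ O ((pochhammer z n)^-1).
Proof.
move=> nK; apply: pochhammer_unit => // i; rewrite zE.
have ci := c_neq0 i; have hi : (i.+1 < K)%N by have := ltn_ord i; lia.
split; first by apply: mulf_neq0; rewrite ?invr_eq0 // intr_eq0.
rewrite invf_div; apply: p_localM => //; first exact: p_local_int.
by apply: p_local_intV => //; exact: p_ndvd_c.
Qed.

Let hB0 : O B.
Proof. by rewrite -[B](subrK r); apply: p_localD. Qed.

Let hB20 : O (1 / 2 + B).
Proof.
apply: p_localD => //; rewrite mul1r.
by apply: (@p_local_natV p 2); exact: p_ndvd2.
Qed.

Let hyp_local n : (n < K)%N -> O (hyp n).
Proof.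
move=> nK; rewrite /hyp2F1 invfM.
do !apply: p_localM => //; try exact: p_local_pochhammer.
  by case: (z_unit nK).
by apply: p_local_factV => //; lia.
Qed.

Let comp_local n : (n < K)%N -> O (fps_comp hyp (Jinv R[i]) n).
Proof.
move=> nK; apply: p_local_fps_comp => // [j jn|i]; last exact: p_local_Jinv.
by apply: hyp_local; lia.
Qed.

Let pow1_local n : (n < p)%N -> O (fps_powc (oneY R[i]) (B - r) n).
Proof. by move=> np; apply: p_local_fps_powc => // i; exact: p_local_Kinv. Qed.

Let pow2_local n : (n < p)%N ->
  O (fps_powc (fun n => (n == 0%N)%:R - 64 * Kinv R[i] n) r n).
Proof.
move=> np; apply: p_local_fps_powc => // i; apply: p_localB => //.
  exact: p_local_nat.
by apply: p_localM => //; [exact: (p_local_nat pp 64) | exact: p_local_Kinv].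
Qed.

Let inner_local n : (n < K)%N ->
  O (fps_mul (fps_powc (fun n => (n == 0%N)%:R - 64 * Kinv R[i] n) r)
       (fps_comp hyp (Jinv R[i])) n).
Proof.
move=> nK; apply: p_local_fps_mul => // i iln.
  by apply: pow2_local; lia.
by apply: comp_local; lia.
Qed.

(** Below [K] no Pochhammer denominator meets [p], and [K < p] keeps the factorials prime to [p]. *)
Lemma htilde_local n : (n < K)%N -> O (htilde A B r n).
Proof.
move=> nK; apply: p_local_fps_mul => // i iln.
  by apply: pow1_local; lia.
by apply: inner_local; lia.
Qed.

(** Strip off the two binomial factors, of constant term 1, then the composition with
    [J^-1 = 64 q + ...]: what is dropped involves only hypergeometric coefficients of index below
    [K]. *)
Let htilde_sub : O (htilde A B r K - hyp K * 64 ^+ K).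
Proof.
rewrite /htilde.
set P1 := fps_powc (oneY _) _; set P2 := fps_powc _ r; set C := fps_comp _ _.
have -> : fps_mul P1 (fps_mul P2 C) K - hyp K * 64 ^+ K =
   (fps_mul P1 (fps_mul P2 C) K - P1 0%N * fps_mul P2 C K) +
   ((fps_mul P2 C K - P2 0%N * C K) + (C K - hyp K * Jinv R[i] 1 ^+ K)).
  by rewrite /P1 /P2 !fps_powc0 Jinv1; ring.
apply: p_localD => //; last apply: p_localD => //.
- by apply: p_local_fps_mul_sub => // i iK; apply: pow1_local; lia.
- by apply: p_local_fps_mul_sub => // i iK; apply: pow2_local; lia.
- apply: p_local_fps_comp_sub => //; first exact: Jinv0.
  by move=> i; exact: p_local_Jinv.
Qed.

(** Isolates [K v - u], the last Pochhammer factor of the denominator and the only one divisible by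
    [p]. *)
Let hypKE k : K = k.+1 -> hyp K * (K%:Z * v - u)%:~R =
  pochhammer B K * pochhammer (1 / 2 + B) K * v%:~R *
  (pochhammer z k)^-1 * ((K`!)%:R)^-1.
Proof.
move=> eK; have kK : (k < K)%N by rewrite eK.
have [zk0 _] := z_unit kK; rewrite eK.
have cK : (k.+1%:Z * v - u)%:~R != 0 :> R[i] by rewrite intr_eq0.
have f0 : ((k.+1)`!)%:R != 0 :> R[i] by rewrite pnatr_eq0 -lt0n fact_gt0.
have ez : pochhammer z k.+1 = pochhammer z k * ((k.+1%:Z * v - u)%:~R / v%:~R).
  by rewrite /pochhammer big_ord_recr /= zE.
rewrite /hyp2F1 ez.
move: (pochhammer z k) (pochhammer B _) (pochhammer (1 / 2 + B) _) zk0 => x y w x0.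
move: ((_ - u)%:~R : R[i]) cK ((_`!)%:R : R[i]) f0 => c c0 f f0.
by field; rewrite ?x0 ?c0 ?f0 ?v0.
Qed.

(** [K v - u] clears the denominator at [p]. If [htilde K] itself were [p]-local, so would be the
    hypergeometric coefficient and then [1 / (K v - u)], because the numerator factors are [p]-adic
    units. *)
Lemma htilde_divides_denominator : divides_denominator p (htilde A B r K).
Proof.
have [k eK] : exists k, K = k.+1 by exists K.-1; lia.
have kK : (k < K)%N by lia.
set c := K%:Z * v - u.
have c0 : c != 0 by rewrite /c eK.
have c0R : c%:~R != 0 :> R[i] by rewrite intr_eq0.
have [zk0 hzk] := z_unit kK.
have [B0 hBV] := pochhammer_unit (n := K) pp (fun i : 'I_K => hB i).
have [B20 hB2V] := pochhammer_unit (n := K) pp (fun i : 'I_K => hB2 i).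
have hf := p_local_factV pp K_ltp.
have f0 : (K`!)%:R != 0 :> R[i] by rewrite pnatr_eq0 -lt0n fact_gt0.
have n64 : 64 != 0 :> R[i] by rewrite pnatr_eq0.
have hypE := hypKE eK.
have hc : O (hyp K * c%:~R).
  rewrite hypE; do !apply: p_localM => //; try exact: p_local_pochhammer.
  exact: p_local_int.
apply: (@divides_denominatorP p _ `|c|%N); first by rewrite absz_gt0.
  have : O (c%:~R * htilde A B r K).
    rewrite -[htilde _ _ _ _](subrK (hyp K * 64 ^+ K)) mulrDr.
    apply: p_localD => //; first by apply: p_localM => //; exact: p_local_int.
    rewrite mulrA [c%:~R * _]mulrC; apply: p_localM => //.
    by apply: p_localX => //; exact: (p_local_nat pp 64).
  case: (intP c) => [|n|n] h; rewrite /= ?mul0r //.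
  - exact: (p_local_nat pp 0).
  - by move: h; rewrite mulrNz mulNr => /(p_localN pp); rewrite opprK.
move=> hh; apply: (not_p_local_intV pp c0 pK).
have hyp64 : O (hyp K * 64 ^+ K).
  by rewrite -[X in O X](subKr (htilde A B r K)); apply: p_localB.
have -> : c%:~R^-1 = (hyp K * 64 ^+ K) * (64^-1) ^+ K * (v%:~R^-1) *
   (pochhammer B K)^-1 * (pochhammer (1 / 2 + B) K)^-1 * pochhammer z k * (K`!)%:R.
  have eh : hyp K = pochhammer B K * pochhammer (1 / 2 + B) K * v%:~R *
      (pochhammer z k)^-1 * ((K`!)%:R)^-1 / c%:~R by rewrite -hypE mulfK.
  rewrite eh exprVn.
  have : 64 ^+ K != 0 :> R[i] by rewrite expf_neq0.
  move: (64 ^+ K : R[i]) (pochhammer z k) (pochhammer B _) (pochhammer (1 / 2 + B) _)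
    zk0 B0 B20 => s x y w x0 y0 w0 s0.
  move: (c%:~R : R[i]) c0R ((_`!)%:R : R[i]) f0 => d d0 f f0.
  by field; rewrite ?x0 ?d0 ?f0 ?v0 ?y0 ?w0 ?s0.
apply: (p_localM pp); last exact: p_local_nat.
apply: (p_localM pp); last first.
  apply: p_local_pochhammer => //; rewrite -[z](addr0) (zE 0).
  by apply: (p_localM pp); [exact: p_local_int | exact: p_local_intV].
apply: (p_localM pp _ hB2V); apply: (p_localM pp _ hBV).
apply: (p_localM pp); last exact: p_local_intV.
apply: (p_localM pp hyp64); apply: (p_localX pp).
by apply: (@p_local_natV p 64); exact: p_ndvd64.
Qed.

End HypergeometricCoefficient.

(** Up to denominators the number is [X + Y s], of norm [X ^ 2 - M Y ^ 2]. If [p] divided the norm,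
    [X / Y] would be a square root of [M] modulo [p]; so the conjugate over the norm gives a
    [p]-local inverse. *)
Lemma quadratic_unit p (M : int) (s : R[i]) (e y : rat) (n : nat) : prime p ->
  s ^+ 2 = M%:~R -> ~ (exists x : int, (x ^+ 2 = M %[mod p%:Z])%Z) ->
  ~~ (p%:Z %| denq e)%Z -> ~~ (p%:Z %| denq y)%Z -> ~~ (p%:Z %| numq y)%Z ->
  ratr e + n%:R + ratr y * s != 0 /\ p_local p ((ratr e + n%:R + ratr y * s)^-1).
Proof.
move=> pp s2 nres pe py pny.
pose d := denq e * denq y.
pose X := numq e * denq y + n%:Z * d; pose Y := numq y * denq e.
have pM (a b : int) : ~~ (p%:Z %| a)%Z -> ~~ (p%:Z %| b)%Z -> ~~ (p%:Z %| a * b)%Z.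
  by rewrite !dvdzE abszM Euclid_dvdM // negb_or => -> ->.
have de0 : (denq e)%:~R != 0 :> R[i] by rewrite intr_eq0 denq_neq0.
have dy0 : (denq y)%:~R != 0 :> R[i] by rewrite intr_eq0 denq_neq0.
have zE : ratr e + n%:R + ratr y * s = (X%:~R + Y%:~R * s) / d%:~R.
  rewrite /X /Y /d !rmorphD !rmorphM /= -pmulrn /ratr.
  by field; rewrite ?de0 ?dy0.
pose nrm := X ^+ 2 - M * Y ^+ 2.
have nrmE (F : fieldType) : nrm%:~R = X%:~R ^+ 2 - M%:~R * Y%:~R ^+ 2 :> F.
  by rewrite rmorphB /= rmorphXn [(M * _)%:~R]rmorphM /= rmorphXn.
have pnrm : ~~ (p%:Z %| nrm)%Z.
  apply/negP => pn; apply: nres.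
  have pY : (Y%:~R : 'F_p) != 0 by rewrite intr_Fp_eq0 // pM.
  pose x : 'F_p := X%:~R / Y%:~R.
  exists (val x)%:Z; apply/eqP; rewrite eqz_mod_dvd -intr_Fp_eq0 //.
  have ex : ((val x)%:Z%:~R : 'F_p) = x by exact: natr_Zp.
  rewrite rmorphB rmorphXn /= ex subr_eq0.
  have pY2 : (Y%:~R : 'F_p) ^+ 2 != 0 by rewrite expf_neq0.
  rewrite /x expr_div_n -(inj_eq (mulIf pY2)) divfK // -subr_eq0.
  by move: pn; rewrite -intr_Fp_eq0 // nrmE.
have nrm0 : nrm%:~R != 0 :> R[i].
  by rewrite intr_eq0; apply: contraNneq pnrm => ->; exact: dvdz0.
have nE : (X%:~R + Y%:~R * s) * (X%:~R - Y%:~R * s) = nrm%:~R.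
  by rewrite nrmE -s2; ring.
have z0 : X%:~R + Y%:~R * s != 0.
  by apply: contraNneq nrm0 => h; rewrite -nE h mul0r.
have d0 : d%:~R != 0 :> R[i] by rewrite intr_eq0 mulf_neq0 // denq_neq0.
rewrite zE; split; first by rewrite mulf_neq0 // invr_eq0.
have -> : ((X%:~R + Y%:~R * s) / d%:~R)^-1 =
    d%:~R * (X%:~R - Y%:~R * s) / nrm%:~R.
  rewrite -nE; move: z0; set a := _ + _; set b := _ - _ => z0.
  have b0 : b != 0 by apply: contraNneq nrm0 => h; rewrite -nE -/b h mulr0.
  by field; rewrite ?z0 ?b0 ?d0.
have hs : p_local p s.
  apply: p_local_alg => //; exists ('X^2 - M%:P); first by rewrite monicXnsubC.
  by rewrite rmorphB /= map_polyXn map_polyC /= rootE !hornerE s2 subrr.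
apply: p_localM => //; last exact: p_local_intV.
apply: p_localM => //; first exact: p_local_int.
apply: p_localB => //; first exact: p_local_int.
by apply: p_localM => //; exact: p_local_int.
Qed.

End Denominators.

(** * Rationality of the exponents *)

Section Exponents.
Variable R : realType.
Implicit Types (z w tau s mu : R[i]).

Lemma cexpD z w : cexp (z + w) = cexp z * cexp w.
Proof.
case: z w => [a b] [c d]; rewrite /cexp /= expRD cosD sinD.
by apply/eqP; rewrite eq_complex /=; apply/andP; split; apply/eqP; ring.
Qed.

Lemma eeD z w : ee (z + w) = ee z * ee w.
Proof. by rewrite /ee mulrDr cexpD. Qed.

Lemma ee0 : ee 0 = 1 :> R[i].
Proof. by rewrite /ee mulr0 /cexp /= expR0 cos0 sin0 mul1r. Qed.

Lemma eeE (a b : R) : ee (a +i* b) =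
  (expR (- (2 * pi * b)))%:C * (cos (2 * pi * a) +i* sin (2 * pi * a)).
Proof. by rewrite /ee /cexp /= !mul0r !add0r. Qed.

Lemma ee1 : ee 1 = 1 :> R[i].
Proof.
rewrite -[1]/(1 +i* 0) eeE !mulr0 oppr0 expR0 mulr1 mul1r.
have -> : 2 * pi = pi + pi :> R by ring.
rewrite cosD sinD cospi sinpi; apply/eqP; rewrite eq_complex /=.
by apply/andP; split; apply/eqP; ring.
Qed.

Lemma eeMn z n : ee (n%:R * z) = ee z ^+ n.
Proof.
elim: n => [|n IH]; first by rewrite mul0r ee0.
by rewrite -natr1 mulrDl mul1r eeD IH exprSr.
Qed.

Lemma ee_neq0 z : ee z != 0.
Proof.
apply/negP => /eqP e; have := ee0.
by rewrite -(subrr z) eeD e mul0r => /eqP; rewrite eq_sym oner_eq0.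
Qed.

Lemma ee_int (k : int) : ee k%:~R = 1 :> R[i].
Proof.
have en n : ee n%:R = 1 :> R[i] by rewrite -[n%:R]mulr1 eeMn ee1 expr1n.
case: (intP k) => [|n|n]; [exact: (en 0%N) | exact: en |].
have := eeD n.+1%:R (- n.+1%:R); rewrite subrr ee0 en mul1r.
by rewrite mulrNz => <-.
Qed.

(** Subtract the floor of the real part. The modulus forces the imaginary part to vanish, and
    [sin (pi a) = 0] with [0 <= a < 1] forces [a = 0]. *)
Lemma ee_eq1 z : ee z = 1 -> exists k : int, z = k%:~R.
Proof.
move=> ez; pose k := Num.floor (complex.Re z); exists k.
apply/eqP; rewrite -subr_eq0; apply/eqP.
have : ee (z - k%:~R) = 1.
  by have := eeD (z - k%:~R) k%:~R; rewrite subrK ee_int mulr1 ez => <-.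
have : 0 <= complex.Re (z - k%:~R) < 1.
  have -> : complex.Re (z - k%:~R) = complex.Re z - k%:~R.
    by rewrite raddfB /=; congr (_ - _); rewrite -(rmorph_int (real_complex R)).
  rewrite subr_ge0 ltrBlDl floor_le_tmp /=.
  by have := lt_succ_floor (complex.Re z); rewrite rmorphD.
case: (z - _) => a b /= /andP[a0 a1]; rewrite eeE.
move/eqP; rewrite eq_complex /= !mul0r subr0 addr0 => /andP[/eqP h1 /eqP h2].
have E0 := expR_gt0 (- (2 * pi * b)).
have pi0 := @pi_gt0 R.
have s0 : sin (2 * pi * a) = 0.
  by move/eqP: h2; rewrite mulf_eq0 gt_eqF //= => /eqP.
have c1 : cos (2 * pi * a) = 1.
  have := cos2Dsin2 (2 * pi * a); rewrite s0 expr0n addr0 => /eqP.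
  rewrite sqrf_eq1 => /orP[/eqP//|/eqP c]; move: h1; rewrite c; lra.
have b0 : b = 0.
  move: h1; rewrite c1 mulr1 => /(congr1 (@ln R)); rewrite expRK ln1.
  by move/eqP; rewrite oppr_eq0 !mulf_eq0 (gt_eqF pi0) pnatr_eq0 /= => /eqP.
have sa : sin (pi * a) = 0.
  have : cos (2 * pi * a) = 1 - (sin (pi * a) ^+ 2) *+ 2.
    have -> : 2 * pi * a = (pi * a) *+ 2 by rewrite mulr2n; ring.
    by have := cos2Dsin2 (pi * a); rewrite mulr2n cosD; lra.
  by rewrite c1 => h; apply/eqP; rewrite -sqrf_eq0; apply/eqP; lra.
have a00 : a = 0.
  apply/eqP; apply: contraT => an0.
  have agt : 0 < a by rewrite lt_neqAle eq_sym an0.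
  have : 0 < sin (pi * a).
    by apply: sin_gt0_pi; rewrite mulr_gt0 //= gtr_pMr.
  by rewrite sa ltxx.
by rewrite a00 b0.
Qed.

(** * Nonvanishing of [q]-expansions and its consequence for exponents *)

Lemma ee_scale (rho : R) : 0 < rho < 1 -> exists2 tau : R[i],
  upper_half_plane tau & ee tau = rho%:C * ee (0 +i* 1).
Proof.
move=> /andP[r0 r1]; have pi0 := @pi_gt0 R.
have p2 : 2 * pi != 0 :> R by rewrite gt_eqF // mulr_gt0.
exists (0 +i* (1 - ln rho / (2 * pi))).
  rewrite /upper_half_plane /=; have : ln rho / (2 * pi) < 0.
    by rewrite pmulr_llt0 ?ln_lt0 ?r0 // invr_gt0 mulr_gt0.
  by lra.
rewrite !eeE mulrA -rmorphM /=; congr (_%:C * _).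
rewrite (_ : - (2 * pi * (1 - ln rho / (2 * pi))) = ln rho + - (2 * pi * 1)).
  by rewrite expRD lnK ?posrE.
by rewrite mulrBr [X in _ - X]mulrCA divff // !mulr1 opprB.
Qed.

Lemma cvg_seq_approx (u : nat -> R[i]^o) (l : R[i]^o) (e : R[i]) :
  u @ \oo --> l -> 0 < e -> exists N, forall n, (N <= n)%N -> `|l - u n| < e.
Proof.
move=> /cvgrPdist_lt h e0; have [N _ hN] := h e e0.
by exists N => n Nn; exact: hN.
Qed.

Lemma geometric_sum_le (rho : R) n : 0 <= rho -> 2 * rho <= 1 ->
  \sum_(i < n) rho ^+ i.+1 <= 2 * rho.
Proof.
move=> r0 r1; suff : \sum_(i < n) rho ^+ i.+1 <= 2 * rho - 2 * rho ^+ n.+1.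
  by have : 0 <= rho ^+ n.+1 by [exact: exprn_ge0]; lra.
elim: n => [|n IH]; first by rewrite big_ord0 expr1 subrr.
rewrite big_ord_recr /= (exprS _ n.+1).
have := exprn_ge0 n.+1 r0; move: (rho ^+ n.+1) IH => x; nra.
Qed.

(** Convergence at one point [q0] bounds the terms there by [K]; at [q = rho q0] with
    [rho = 1 / (4 K)] the tail is at most [1/2] and cannot cancel the constant term 1. *)
Lemma qsum_nonzero (c : nat -> R[i]) (w : R[i] -> R[i]) : c 0%N = 1 ->
  (forall tau, upper_half_plane tau -> qsum c tau @ \oo --> (w tau : R[i]^o)) ->
  exists2 tau, upper_half_plane tau & w tau != 0.
Proof.
move=> c0 hw.
have i0 : upper_half_plane (0 +i* 1 : R[i]) by rewrite /upper_half_plane /= ltr01.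
pose q0 := ee (0 +i* 1 : R[i]).
have [N hN] := cvg_seq_approx (hw _ i0) (ltr01 : 0 < 1 :> R[i]).
have tail n : (N <= n)%N -> `|c n * q0 ^+ n| <= 2.
  move=> Nn.
  have -> : c n * q0 ^+ n = (w (0 +i* 1) - qsum c (0 +i* 1) n) -
      (w (0 +i* 1) - qsum c (0 +i* 1) n.+1).
    by rewrite /qsum big_ord_recr /= -/q0; ring.
  apply: le_trans (ler_normB _ _) _.
  rewrite -[2]/(1 + 1); apply: lerD; apply: ltW; apply: hN => //; exact: leqW.
pose a n : R := complex.Re `|c n * q0 ^+ n|.
have aE n : `|c n * q0 ^+ n| = (a n)%:C.
  by rewrite /a normc_def.
have a0 n : 0 <= a n by rewrite -lecR -aE -[X in X <= _]/(0 : R[i]).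
pose K := 2 + \sum_(i < N) a i.
have sa : 0 <= \sum_(i < N) a i by exact: sumr_ge0.
have aK n : a n <= K.
  have [Nn|nN] := leqP N n.
    have : a n <= 2 by rewrite -lecR -aE (rmorph_nat (real_complex R) 2); exact: tail.
    by rewrite /K; lra.
  rewrite /K (bigD1 (Ordinal nN)) //=.
  have : 0 <= \sum_(i < N | i != Ordinal nN) a i by exact: sumr_ge0.
  by lra.
have K2 : 2 <= K by rewrite /K; lra.
pose rho := (4 * K)^-1.
have rho0 : 0 < rho by rewrite invr_gt0; lra.
have Krho : K * rho = 4^-1 by rewrite /rho; field; rewrite gt_eqF //; lra.
have rho1 : 2 * rho <= 1 by nra.
have [|tau htau etau] := @ee_scale rho; first by rewrite rho0; lra.
exists tau => //; apply/negP => /eqP w0.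
have e4 : (0 : R)%:C < (4^-1)%:C :> R[i] by rewrite ltcR invr_gt0.
have [N' hN'] := cvg_seq_approx (hw _ htau) e4.
have := hN' N'.+1 (leqnSn _); rewrite w0 sub0r normrN.
pose T := \sum_(i < N') c i.+1 * ee tau ^+ i.+1.
have -> : qsum c tau N'.+1 = 1 + T by rewrite /qsum big_ord_recl /= c0 expr0 mulr1.
have hT : `|T| <= (2^-1)%:C.
  apply: le_trans (ler_norm_sum _ _ _) _.
  apply: (@le_trans _ _ (\sum_(i < N') (K * rho ^+ i.+1)%:C)).
    apply: ler_sum => i _.
    have -> : c i.+1 * ee tau ^+ i.+1 = (rho ^+ i.+1)%:C * (c i.+1 * q0 ^+ i.+1).
      by rewrite etau exprMn rmorphXn /=; ring.
    rewrite normrM aE ger0_norm; last first.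
      by rewrite -[X in X <= _]/((0 : R)%:C) lecR exprn_ge0 // ltW.
    rewrite -rmorphM /= lecR mulrC ler_wpM2r // exprn_ge0 // ltW //.
  rewrite -rmorph_sum /= lecR -mulr_sumr.
  have := @geometric_sum_le rho N' (ltW rho0) rho1.
  by move: (\sum_(_ < _) _) => S hS; nra.
have : 1 <= `|1 + T| + `|T|.
  by have := ler_normB (1 + T) T; rewrite addrK normr1.
move=> h1 h2; have : 1 < (4^-1)%:C + (2^-1)%:C :> R[i].
  by apply: le_lt_trans h1 _; apply: ltr_leD.
by rewrite -rmorphD /= -[1]/(1%:C) ltcR; lra.
Qed.

(** The series depends on [q] only, so [tau -> tau + 1] multiplies [f] by [ee s]; compare at a point
    where [f] does not vanish. *)
Lemma leading_exponent_multiplier (f : R[i] -> R[i]) s mu :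
  leading_exponent f s ->
  (forall tau, upper_half_plane tau -> f (tau + 1) = mu * f tau) -> ee s = mu.
Proof.
move=> [lam [c [lam0 c0 hf]]] hmu.
have /choice[w hw] : forall tau, exists y : R[i], upper_half_plane tau ->
    qsum c tau @ \oo --> (y : R[i]^o) /\ f tau = lam * ee (s * tau) * y.
  move=> tau; have [h|h] := pselect (upper_half_plane tau); last by exists 0.
  by have [y h1 h2] := hf tau h; exists y.
have [tau htau wtau] := qsum_nonzero c0 (fun t ht => (hw t ht).1).
have htau1 : upper_half_plane (tau + 1).
  by move: htau; rewrite /upper_half_plane /=; case: tau {wtau} => a b /=; rewrite addr0.
have [h1 h2] := hw _ htau; have [h3 h4] := hw _ htau1.
have ew : w (tau + 1) = w tau.
  have eq : qsum c (tau + 1) = qsum c tau.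
    by apply/funext => n; rewrite /qsum eeD ee1 mulr1.
  rewrite eq in h3; apply: (cvg_unique _ h3 h1); exact: norm_hausdorff.
have := hmu _ htau; rewrite h4 h2 ew mulrDr mulr1 eeD.
have x0 : lam * ee (s * tau) * w tau != 0.
  by apply: mulf_neq0 => //; apply: mulf_neq0 => //; exact: ee_neq0.
move=> h; apply: (mulfI x0); rewrite [RHS]mulrC -h; ring.
Qed.

Lemma mulmx_conj_exp (V D P : 'M[R[i]]_2) n : V \in unitmx ->
  V *m P *m invmx V = D -> P ^+ n = 1 -> D ^+ n = 1.
Proof.
move=> hV <- hP; suff -> : (V *m P *m invmx V) ^+ n = V *m P ^+ n *m invmx V.
  by rewrite hP mulmx1 mulmxV.
elim: n {hP} => [|n IH]; first by rewrite !expr0 mulmx1 mulmxV.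
rewrite !exprS IH -!mulmxE !mulmxA; congr (_ *m _ *m _).
by rewrite mulmxKV.
Qed.

(** Translation by 1 multiplies the [j]-th component by [ee (m j)], a root of unity as [rho Tmx] has
    finite order; hence [ee (n s) = 1] and [n s] is an integer. *)
Lemma leading_exponent_rational (rho : 'M[int]_2 -> 'M[R[i]]_2) (k0 : int)
    (F : R[i] -> 'cV[R[i]]_2) (X : 'M[R[i]]_2) (m : 'I_2 -> R[i])
    (j : 'I_2) (s : R[i]) :
  vvmf rho k0 F -> (exists2 n : nat, (0 < n)%N & rho Tmx ^+ n = 1) ->
  X \in unitmx -> X *m rho Tmx *m invmx X = diag_mx (\row_j ee (m j)) ->
  leading_exponent (fun tau => (X *m F tau) j 0) s -> is_rational s.
Proof.
move=> [_ hF _] [n n0 hn] hX hdiag hs.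
have T10 : Tmx 1 0 = 0 by rewrite !mxE.
have T11 : Tmx 1 1 = 1 by rewrite !mxE.
have T00 : Tmx 0 0 = 1 by rewrite !mxE.
have T01 : Tmx 0 1 = 1 by rewrite !mxE.
have hT : Gamma0_2 Tmx.
  split; last by rewrite T10 dvdz0.
  rewrite /SL2Z /= -det_tr det_trig; last first.
    by apply/is_trig_mxP => -[[|[|//]] ?] [[|[|//]] ?] //= _; rewrite !mxE.
  by rewrite !big_ord_recl big_ord0 !mxE.
have hshift tau : upper_half_plane tau -> F (tau + 1) = rho Tmx *m F tau.
  move=> htau; rewrite -hF // /slash /mobius /autfac T10 T11 T00 T01.
  by rewrite mul0r add0r mul1r divr1 exp1rz scale1r.
have es : ee s = ee (m j).
  apply: (leading_exponent_multiplier hs) => tau htau.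
  rewrite hshift // mulmxA.
  have -> : X *m rho Tmx = diag_mx (\row_j ee (m j)) *m X.
    by rewrite -hdiag -mulmxA mulVmx // mulmx1.
  by rewrite -mulmxA mul_diag_mx !mxE.
have em : ee (m j) ^+ n = 1.
  have := mulmx_conj_exp hX hdiag hn.
  have diagX k : diag_mx (\row_j ee (m j)) ^+ k =
      diag_mx (\row_j ee (m j) ^+ k) :> 'M[R[i]]_2.
    elim: k => [|k IH].
      by apply/matrixP => a b; rewrite expr0 !mxE.
    rewrite exprS IH -mulmxE mulmx_diag; congr diag_mx.
    by apply/rowP => b; rewrite !mxE exprS.
  by rewrite diagX => /matrixP/(_ j j); rewrite !mxE eqxx.
have [k hk] : exists k : int, n%:R * s = k%:~R by apply: ee_eq1; rewrite eeMn es.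
exists (k%:~R / n%:R); rewrite fmorph_div /= ratr_int ratr_nat -hk mulrC mulKf //.
by rewrite pnatr_eq0 -lt0n.
Qed.

End Exponents.

(** * The field generated by a square root *)

Section QuadraticField.
Variables (R : realType) (M : int) (s : R[i]).
Hypothesis s2 : s ^+ 2 = M%:~R.
Hypothesis M_nonsquare : forall q : rat, q ^+ 2 != M%:~R.

Let ratM : M%:~R = ratr M%:~R :> R[i].
Proof. by rewrite ratr_int. Qed.

Lemma horner_sqrt (f : {poly rat}) :
  exists x y : rat, (map_poly ratr f).[s] = ratr x + ratr y * s.
Proof.
elim/poly_ind: f => [|f c [x [y h]]].
  by exists 0, 0; rewrite rmorph0 horner0 rmorph0 mul0r addr0.
exists (y * M%:~R + c), x.
rewrite rmorphD rmorphM /= map_polyX map_polyC !hornerE h /= rmorphD rmorphM /=.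
by rewrite -ratM -s2; ring.
Qed.

(** Multiply by the conjugate of the denominator, whose norm is nonzero because [M] is not a
    rational square. *)
Lemma Qadj_sqrt z : Qadj s z -> exists x y : rat, z = ratr x + ratr y * s.
Proof.
move=> [f [g [g0 ->]]]; have [a [b ef]] := horner_sqrt f.
have [c [d eg]] := horner_sqrt g; rewrite ef; rewrite eg in g0 *.
pose n := c ^+ 2 - M%:~R * d ^+ 2.
have n0 : n != 0.
  rewrite /n subr_eq0; have [d0|d0] := eqVneq d 0.
    apply: contraNneq g0; rewrite d0 expr0n mulr0 => /eqP; rewrite sqrf_eq0 => /eqP->.
    by rewrite rmorph0 mul0r addr0.
  have := M_nonsquare (c / d); apply: contraNneq => h.
  by rewrite expr_div_n h mulfK // expf_neq0.
have n0R : ratr n != 0 :> R[i] by rewrite fmorph_eq0.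
have nE : ratr n = (ratr c + ratr d * s) * (ratr c - ratr d * s) :> R[i].
  by rewrite /n rmorphB rmorphXn rmorphM rmorphXn /= -ratM -s2; ring.
exists ((a * c - b * d * M%:~R) / n), ((b * c - a * d) / n).
have h0 : ratr c - ratr d * s != 0.
  by apply: contraNneq n0R => h; rewrite nE h mulr0.
have key (a' b' c' d' : R[i]) : c' + d' * s != 0 -> c' - d' * s != 0 ->
    (a' + b' * s) / (c' + d' * s) =
    (a' * c' - b' * d' * s ^+ 2) / ((c' + d' * s) * (c' - d' * s)) +
    (b' * c' - a' * d') / ((c' + d' * s) * (c' - d' * s)) * s.
  by move=> h1 h2; field; rewrite h1 h2.
rewrite key // -nE s2 ratM !fmorph_div /=.
by rewrite [ratr (a * c - _)]rmorphB [ratr (b * c - _)]rmorphB !rmorphM.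
Qed.

End QuadraticField.

(** A rational square root of [M] would be an integer, hence a square root modulo [p]. *)
Lemma nonresidue_nonsquare (p : nat) (M : int) :
  ~ (exists x : int, (x ^+ 2 = M %[mod p%:Z])%Z) ->
  forall q : rat, q ^+ 2 != M%:~R.
Proof.
move=> nres q; apply/eqP => q2; apply: nres.
have e : numq q ^+ 2 = M * denq q ^+ 2.
  apply/eqP; rewrite -(eqr_int rat) rmorphXn rmorphM rmorphXn /= -q2 numqE.
  by rewrite exprMn.
have d1 : denq q = 1.
  have cop := coprime_num_den q.
  have : (`|denq q| ^ 2 %| `|numq q| ^ 2)%N.
    by rewrite -!abszX e abszM dvdn_mull.
  have : coprime (`|numq q| ^ 2) (`|denq q| ^ 2) by rewrite coprimeXl // coprimeXr.
  rewrite /coprime => /eqP + /gcdn_idPr => -> /eqP.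
  rewrite -mulnn => /eqP; rewrite -(absz_denq q) /= => h.
  by congr Posz; nia.
by exists (numq q); rewrite e d1 expr1n mulr1.
Qed.

Lemma large_prime_ndvdz (p : nat) (z : int) :
  z != 0 -> (`|z| < p)%N -> ~~ (p%:Z %| z)%Z.
Proof.
move=> z0 zp; rewrite dvdzE /=; apply/negP => /dvdn_leq.
by rewrite absz_gt0 => /(_ z0); rewrite leqNgt zp.
Qed.

(** [K] represents [u / v] modulo [p], nonzero since [p] does not divide [u]. *)
Lemma linear_congruence (p : nat) (u v : int) : prime p ->
  ~~ (p%:Z %| u)%Z -> ~~ (p%:Z %| v)%Z ->
  exists2 K : nat, (0 < K < p)%N & (p%:Z %| K%:Z * v - u)%Z.
Proof.
move=> pp; rewrite -!intr_Fp_eq0 // => pu pv.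
pose x : 'F_p := u%:~R / v%:~R.
have ex : ((val x)%:Z%:~R : 'F_p) = x by exact: natr_Zp.
exists (val x); last by rewrite -intr_Fp_eq0 // rmorphB rmorphM /= ex divfK // subrr.
apply/andP; split; last by have := ltn_ord x; rewrite [X in (_ < X)%N]Fp_cast.
rewrite lt0n; apply/negP => /eqP x0.
have : x != 0 by rewrite mulf_neq0 // invr_eq0.
by rewrite -ex x0 eqxx.
Qed.

Theorem theorem5p23 (R : realType)
    (rho : 'M[int]_2 -> 'M[R[i]]_2)
    (hrho : is_rep rho) (hirr : irreducible_rep rho)
    (k0 : int) (hk0 : least_weight rho k0)
    (F : R[i] -> 'cV[R[i]]_2) (hF : vvmf rho k0 F) (hF0 : nonzero_form F)
    (a b c : R[i])
    (hode : forall tau : R[i], upper_half_plane tau ->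
       Dk (k0 + 2) (Dk k0 F) tau + (a * G tau) *: Dk k0 F tau
       + (b * G tau ^+ 2 + c * E4 tau) *: F tau = 0)
    (r : R[i]) (hr : r ^+ 2 - (a + 1 / 3) * r + b + 4 * c = 0)
    (hT : exists2 n : nat, (0 < n)%N & rho Tmx ^+ n = 1)
    (hc : is_rational c) (hQr : Qdegree (Qadj r) 2)
    (X : 'M[R[i]]_2) (m : 'I_2 -> R[i]) (hX : X \in unitmx)
    (hdiag : X *m rho Tmx *m invmx X = diag_mx (\row_j ee (m j)))
    (hm : `|m 0| <= `|m 1|)
    (l : 'I_2 -> R[i])
    (hl : forall j : 'I_2,
       leading_exponent (fun tau => (X *m F tau) j 0) (k0%:~R / 12 + l j))
    (A B : R[i]) (hA : A = r + l 0) (hB : B = r + l 1)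
    (u v : int) (huv : A - B = u%:~R / v%:~R) (hv : 1 < v)
    (hcop : coprimez u v)
    (M : int) (hM : squarefree M)
    (hQM : Qadj r = Qadj (sqrtC (M%:~R : R[i])))
    (hS : infinite_set (Stilde M u v)) :
  (exists K0 : nat, forall K p : nat, (K0 <= K)%N ->
     p%:Z = - u + K%:Z * v -> Stilde M u v p ->
     divides_denominator p (htilde A B r K) /\
     (forall J : nat, (0 < J < K)%N -> p_integral p (htilde A B r J))) /\
  (let P := [set p : nat | prime p /\
              exists2 K : nat, (0 < K)%N & divides_denominator p (htilde A B r K)] in
   infinite_set P /\ 0 < lower_prime_density R P).
Proof.
set s := sqrtC (M%:~R : R[i]) in hQM.
have s2 : s ^+ 2 = M%:~R by exact: sqrtCK.
(* One element of [Stilde M u v] already shows that [M] is not a rational square. *)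
have [p1 [_ _ nres1 _]] : Stilde M u v !=set0.
  by apply/set0P; apply/eqP => S0; apply: hS; rewrite S0.
have Mns := nonresidue_nonsquare nres1.
have [x [y rE]] : exists x y : rat, r = ratr x + ratr y * s.
  apply: (Qadj_sqrt s2 Mns); rewrite -hQM.
  exists 'X, 1; rewrite map_polyX hornerX rmorph1 hornerC divr1 oner_eq0.
  by split.
(* Otherwise [r] is rational, and [Qadj r = Qadj s] would make [s] rational. *)
have y0 : y != 0.
  apply/eqP => y0; rewrite y0 rmorph0 mul0r addr0 in rE.
  have : Qadj r s.
    rewrite hQM; exists 'X, 1; rewrite map_polyX hornerX rmorph1 hornerC divr1 oner_eq0.
    by split.
  move=> [f [g [_ sE]]].
  have sq : s = ratr (f.[x] / g.[x]) by rewrite sE rE fmorph_div /= -!horner_map.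
  have := Mns (f.[x] / g.[x]); rewrite -(inj_eq (fmorph_inj (@ratr R[i]))) /=.
  by rewrite rmorphXn /= -sq s2 ratr_int eqxx.
have [q1 lE] : exists q : rat, l 1 = ratr q.
  have [q hq] := leading_exponent_rational hF hT hX hdiag (hl 1).
  exists (q - k0%:~R / 12); rewrite rmorphB fmorph_div /= -hq ratr_int ratr_nat.
  by rewrite addrAC subrr add0r.
have u0 : u != 0.
  by apply/eqP => u0; move: hcop; rewrite u0 /coprimez gcd0z; lia.
pose e1 := x + q1; pose e2 := 1 / 2 + x + q1.
(* A prime beyond [P0] divides no nonzero entry of this list; this makes the rational data
   [p]-integral, and [u], [v], [numq y] prime to [p]. *)
pose zs := [:: v; u; denq q1; denq x; denq y; numq y; denq e1; denq e2].
pose P0 := (3 + \sum_(z <- zs) `|z|)%N.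
have nd (p : nat) z : (P0 < p)%N -> z \in zs -> z != 0 -> ~~ (p%:Z %| z)%Z.
  move=> pP0 zin z0; apply: large_prime_ndvdz => //; apply: leq_ltn_trans pP0.
  by rewrite /P0 (big_rem z) //= addnCA leq_addr.
have P0_ge3 : (3 <= P0)%N by rewrite leq_addr.
clearbody P0.
have core p K : prime p -> (P0 < p)%N ->
    ~ (exists x : int, (x ^+ 2 = M %[mod p%:Z])%Z) -> (0 < K < p)%N ->
    (p%:Z %| K%:Z * v - u)%Z ->
    divides_denominator p (htilde A B r K) /\
    (forall J : nat, (0 < J < K)%N -> p_integral p (htilde A B r J)).
  move=> pp pP0 nres /andP[K0 Kp] pK.
  have p3 : (3 < p)%N by exact: leq_ltn_trans pP0.
  have v0 : v != 0 by lia.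
  have pv : ~~ (p%:Z %| v)%Z by apply: nd; rewrite // !inE eqxx.
  have pq1 : ~~ (p%:Z %| denq q1)%Z.
    by apply: nd; rewrite ?denq_neq0 // !in_cons eqxx !orbT.
  have px : ~~ (p%:Z %| denq x)%Z.
    by apply: nd; rewrite ?denq_neq0 // !in_cons eqxx !orbT.
  have py : ~~ (p%:Z %| denq y)%Z.
    by apply: nd; rewrite ?denq_neq0 // !in_cons eqxx !orbT.
  have pny : ~~ (p%:Z %| numq y)%Z.
    by apply: nd; rewrite ?numq_eq0 // !in_cons eqxx !orbT.
  have pe1 : ~~ (p%:Z %| denq e1)%Z.
    by apply: nd; rewrite ?denq_neq0 // !in_cons eqxx !orbT.
  have pe2 : ~~ (p%:Z %| denq e2)%Z.
    by apply: nd; rewrite ?denq_neq0 // !in_cons eqxx !orbT.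
  have hs : p_local p s.
    apply: p_local_alg => //; exists ('X^2 - M%:P); first by rewrite monicXnsubC.
    by rewrite rmorphB /= map_polyXn map_polyC /= rootE !hornerE s2 subrr.
  have hr' : p_local p r.
    rewrite rE; apply: p_localD => //; first exact: p_local_rat.
    by apply: p_localM => //; exact: p_local_rat.
  have hBr : p_local p (B - r).
    by rewrite hB addrAC subrr add0r lE; exact: p_local_rat.
  have hB1 i : B + i%:R != 0 /\ p_local p ((B + i%:R)^-1).
    have -> : B + i%:R = ratr e1 + i%:R + ratr y * s.
      by rewrite hB lE rE /e1 rmorphD /=; ring.
    exact: quadratic_unit s2 nres pe1 py pny.
  have hB2 i : 1 / 2 + B + i%:R != 0 /\ p_local p ((1 / 2 + B + i%:R)^-1).
    have -> : 1 / 2 + B + i%:R = ratr e2 + i%:R + ratr y * s.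
      rewrite hB lE rE /e2 !rmorphD /= fmorph_div /= rmorph1 ratr_nat; ring.
    exact: quadratic_unit s2 nres pe2 py pny.
  split; first exact: (htilde_divides_denominator pp p3 hv hcop pv huv).
  move=> J /andP[_ JK]; apply: p_local_p_integral.
  exact: (htilde_local pp p3 hv hcop pv huv hr' hBr K0 Kp pK JK).
(* Some [0 < K < p] satisfies [K v = u] modulo [p], so every inert prime beyond [P0] occurs; the
   density bound rests on this. *)
have inP p : prime p -> (P0 < p)%N ->
    ~ (exists x : int, (x ^+ 2 = M %[mod p%:Z])%Z) ->
    exists2 K : nat, (0 < K)%N & divides_denominator p (htilde A B r K).
  move=> pp pP0 nres.
  have [||K hK pK] := @linear_congruence p u v pp.
  - by apply: nd; rewrite // !inE eqxx orbT.
  - by apply: nd; rewrite // ?inE ?eqxx //; lia.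
  have [h _] := core p K pp pP0 nres hK pK.
  by exists K => //; case/andP: hK.
split.
  (* As [v >= 2], [p = K v - u >= 2 K - |u| > K + P0], which yields both [K < p] and [P0 < p]. *)
  exists (P0 + `|u|).+1 => K p KK pE [pp _ nres _].
  have h1 : (P0 < p)%N by nia.
  have h2 : (K < p)%N by nia.
  apply: core => //; first by rewrite h2 andbT; lia.
  by rewrite addrC -pE.
move=> P; split.
  (* All primes of [Stilde M u v] beyond [P0] lie in [P]. *)
  apply: contra_not hS => finP.
  apply: (@sub_finite_set _ _ (P `|` `I_P0.+1)); last first.
    by rewrite finite_setU; split => //; exact: finite_II.
  move=> p [pp _ nres _]; have [pP|pP] := ltnP P0 p; last by right.
  by left; split => //; exact: inP.
have M0 : M != 0.
  by have := Mns 0; rewrite expr0n /= eq_sym intr_eq0.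
have Mnsz : ~ (exists z : int, z ^+ 2 = M).
  by move=> [z zM]; have := Mns z%:~R; rewrite -zM rmorphXn eqxx.
have [chi [chiM chiDN chi_val chi_eq0 [[n0 chin0] chi_nres]]] :=
  quadratic_character_exists M0 Mnsz.
have N0 : (0 < 8 * `|M|)%N by rewrite muln_gt0 /= absz_gt0.
pose chiR n : R := (chi n)%:~R.
have [c' [n1 [c'0 hth]]] : exists c' : R, exists n1 : nat,
    0 < c' /\ forall n, (n1 <= n)%N ->
      c' * n%:R <= theta R (fun p => chiR p == -1) n.
  apply: (@theta_inert_linear_lower R (8 * `|M|)%N chiR N0 _ _ _ _ n0).
  - by move=> a' b'; rewrite /chiR chiM rmorphM.
  - by move=> n; rewrite /chiR chiDN.
  - move=> n; rewrite /chiR; have [->|->|->] := chi_val n;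
      [constructor 1 | constructor 2 | constructor 3] => //; exact: mulrNz.
  - by move=> n; rewrite /chiR intr_eq0 chi_eq0.
  - by rewrite /chiR chin0 mulrNz.
apply: (lower_prime_density_gt0 (p0 := P0) _ c'0 hth) => p pp pP0 chip.
split => //; apply: inP => //; apply: chi_nres => //.
by apply/eqP; rewrite -(eqr_int R) mulrNz.
Qed.
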